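(* Fix $K\ge 2$ and consider the $K$-armed Gaussian bandit setting described in the context. (a) (Pre-specified constraints.) Let $p\in[0,1]^K$ with $\sum_a p_a\le 1$. Then any $p$-fair $\delta$-PAC algorithm satisfies, for every $\theta\in\Theta$ and every $\delta\in(0,1/2)$, $$\frac{\mathbb{E}_\theta[\tau_\delta]}{\log(1/(2.4\delta))}\ \ge\ T^\star_p(\theta).$$ (b) ($\theta$-dependent constraints.) Let $p:\mathbb{R}^K\to[0,1]^K$ be continuous with $\sum_a p_a(\theta')\le 1$ for all $\theta'$. Then any asymptotically $p(\theta)$-fair $\delta$-PAC algorithm satisfies, for every $\theta\in\Theta$, $$\liminf_{\delta\to 0}\frac{\mathbb{E}_\theta[\tau_\delta]}{\log(1/\delta)}\ \ge\ T^\star_{p(\theta)}(\theta).$$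
   Context: Bandit model: arms $[K]=\{1,\dots,K\}$; an unknown parameter $\theta\in\Theta:=\{\theta\in\mathbb{R}^K:\ \arg\max_a\theta_a \text{ is a singleton}\}$. In each round $t\ge1$ the learner chooses an arm $a_t\in[K]$ and observes $r_t\sim\mathcal{N}(\theta_{a_t},1)$, independently of the past given $a_t$. Let $a^\star=\arg\max_a\theta_a$, $\Delta_a=\theta_{a^\star}-\theta_a$, $N_a(t)=\sum_{s\le t}\mathbf 1\{a_s=a\}$, and $\mathcal F_t=\sigma(a_1,r_1,\dots,a_t,r_t)$. An algorithm (for confidence $\delta$) consists of a sampling rule ($a_t$ is $\mathcal F_{t-1}$-measurable, possibly using independent internal randomization), a stopping time $\tau_\delta$ w.r.t. $(\mathcal F_t)$, and a decision $\hat a_{\tau_\delta}$ that is $\mathcal F_{\tau_\delta}$-measurable. For $p\in[0,1]^K$ with $\sum_ap_a\le1$ let $\Sigma_p=\{w\in[0,1]^K:\ w_a\ge p_a\ \forall a,\ \sum_a w_a=1\}$ and define the characteristic time $$T^\star_p(\theta)=2\inf_{w\in\Sigma_p}\max_{a\ne a^\star}\frac{w_a^{-1}+w_{a^\star}^{-1}}{\Delta_a^2}.$$ An algorithm is $p$-fair $\delta$-PAC (for pre-specified $p\in[0,1]^K$) if for all $\theta\in\Theta$ and $\delta\in(0,1/2)$: (i) $\mathbb{E}_\theta[N_a(\tau_\delta)]/\mathbb{E}_\theta[\tau_\delta]\ge p_a$ for all $a$; (ii) $\mathbb{P}_\theta(\hat a_{\tau_\delta}\ne a^\star)\le\delta$;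 (iii) $\mathbb{P}_\theta(\tau_\delta<\infty)=1$. For a continuous $p:\mathbb{R}^K\to[0,1]^K$, an algorithm (family indexed by $\delta$) is asymptotically $p(\theta)$-fair $\delta$-PAC if for all $\theta\in\Theta$ and $\delta\in(0,1/2)$, (ii) and (iii) hold, and (i') $\liminf_{\delta\to0}\mathbb{E}_\theta[N_a(\tau_\delta)]/\mathbb{E}_\theta[\tau_\delta]\ge p_a(\theta)$ for all $a$.
   Formalization: In (a) the bound is proved as T*_p(θ)·log(1/(2.4δ)) ≤ E[τ]: the ratio form fails for δ in (5/12,1/2), where the logarithm is negative, and is undefined at δ=5/12. Fairness (i),(i') is likewise stated in multiplied form to avoid 0/0 and ∞/∞. *)

(* Defs.v *)
From HB Require Import structures.
From mathcomp Require Import all_boot all_order all_algebra.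
From mathcomp Require Import all_classical all_reals all_analysis.
Set Implicit Arguments. Unset Strict Implicit. Unset Printing Implicit Defensive.
Import Order.TTheory GRing.Theory Num.Theory.
Import numFieldNormedType.Exports.
Local Open Scope classical_set_scope.
Local Open Scope ring_scope.

(* K-armed Gaussian bandit, unit variance.  Arms are 'I_K, a parameter is   *)
(* theta : 'I_K -> R.  A history of length t is the sequence                *)
(* [:: (a_1,r_1); ...; (a_t,r_t)].                                          *)

Section Bandit.
Variables (R : realType) (K : nat).

Definition hist := seq ('I_K * R).

(* An algorithm: a (possibly randomized) sampling rule giving the          *)
(* probability of pulling arm a in round t+1 given the history of length t, *)
(* a stopping rule (tau = first t >= 0 such that stp (history of length t)) *)
(* and a decision rule (recommended arm = dec (history of length tau)).     *)
Record algo := Algo {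
  pol : hist -> 'I_K -> R ;
  stp : hist -> bool ;
  dec : hist -> 'I_K }.

(* Well-formedness: pol is a probability vector, and all three rules are   *)
(* measurable functions of the history (discrete arms x Borel rewards).    *)
Definition valid_algo (A : algo) : Prop :=
  (forall h a, 0 <= pol A h a) /\
  (forall h, \sum_(a < K) pol A h a = 1) /\
  (forall (t : nat) (as_ : t.-tuple 'I_K) (a : 'I_K),
      measurable_fun [set: t.-tuple R] (fun rs : t.-tuple R => pol A (zip as_ rs) a)) /\
  (forall (t : nat) (as_ : t.-tuple 'I_K),
      measurable [set rs : t.-tuple R | stp A (zip as_ rs)]) /\
  (forall (t : nat) (as_ : t.-tuple 'I_K) (b : 'I_K),
      measurable [set rs : t.-tuple R | dec A (zip as_ rs) = b]).

Local Open Scope ereal_scope.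

Definition indic (b : bool) : \bar R := if b then 1 else 0.

(* ev theta A n h g = E_theta[ g(H_{t+n}) | H_t = h ] where the trajectory  *)
(* is generated by A in the bandit with parameter theta: at each round the *)
(* arm a is drawn with probability pol A h a, and the reward is drawn from *)
(* N(theta a, 1) independently of the past given the arm.                   *)
Fixpoint ev (theta : 'I_K -> R) (A : algo) (n : nat) (h : hist)
    (g : hist -> \bar R) : \bar R :=
  match n with
  | 0 => g h
  | n'.+1 => \sum_(a < K) ((pol A h a)%:E *
        \int[normal_prob (theta a) 1%R]_r ev theta A n' (rcons h (a, r)) g)
  end.

Definition Pn (theta : 'I_K -> R) (A : algo) (n : nat) (E : hist -> bool) :=
  ev theta A n [::] (fun h => indic (E h)).

Definition not_stopped_upto (A : algo) (n : nat) (h : hist) : bool :=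
  [forall s : 'I_n.+1, ~~ stp A (take s h)].

Definition stops_at (A : algo) (n : nat) (h : hist) : bool :=
  stp A (take n h) && [forall s : 'I_n, ~~ stp A (take s h)].

(* E_theta[tau] = sum_{n >= 0} P_theta(tau > n)  (valued in [0, +oo]). *)
Definition Etau (theta : 'I_K -> R) (A : algo) : \bar R :=
  \sum_(0 <= n <oo) Pn theta A n (not_stopped_upto A n).

Definition Pfinite (theta : 'I_K -> R) (A : algo) : \bar R :=
  \sum_(0 <= n <oo) Pn theta A n (stops_at A n).

Definition Perr (theta : 'I_K -> R) (A : algo) (astar : 'I_K) : \bar R :=
  \sum_(0 <= n <oo) Pn theta A n (fun h => stops_at A n h && (dec A h != astar)).

(* arm pulled in round n+1 is b, for a history h of length >= n+1. *)
Definition pulled_at (n : nat) (b : 'I_K) (h : hist) : bool :=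
  if drop n h is (c, _) :: _ then c == b else false.

(* E_theta[N_b(tau)] = sum_{t >= 1} P_theta(tau >= t, a_t = b)
                    = sum_{n >= 0} P_theta(tau > n, a_{n+1} = b). *)
Definition ENa (theta : 'I_K -> R) (A : algo) (b : 'I_K) : \bar R :=
  \sum_(0 <= n <oo) Pn theta A n.+1
     (fun h => not_stopped_upto A n (take n h) && pulled_at n b h).

Definition best_arm (theta : 'I_K -> R) (astar : 'I_K) : Prop :=
  forall a, a != astar -> (theta a < theta astar)%R.

Definition Sigma_p (p : 'I_K -> R) : set ('I_K -> R) :=
  [set w | (forall a, (0 <= w a <= 1)%R) /\ (forall a, (p a <= w a)%R) /\
           (\sum_(a < K) w a)%R = 1%R].

Definition einv (x : R) : \bar R := if x == 0%R then +oo else (x^-1)%:E.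

Definition Tstar (p : 'I_K -> R) (theta : 'I_K -> R) (astar : 'I_K) : \bar R :=
  2%:E * ereal_inf [set \big[Order.max/-oo]_(a | a != astar)
                         ((einv (w a) + einv (w astar)) *
                          (((theta astar - theta a) ^+ 2)^-1)%:E)
                    | w in Sigma_p p].

Definition pfair_PAC (p : 'I_K -> R) (A : R -> algo) : Prop :=
  forall theta astar, best_arm theta astar ->
  forall delta : R, (0 < delta < 2^-1)%R ->
    (forall a, (p a)%:E * Etau theta (A delta) <= ENa theta (A delta) a) /\
    Perr theta (A delta) astar <= delta%:E /\
    Pfinite theta (A delta) = 1.

Definition asym_pfair_PAC (p : ('I_K -> R) -> 'I_K -> R) (A : R -> algo) : Prop :=
  forall theta astar, best_arm theta astar ->
    (forall delta : R, (0 < delta < 2^-1)%R ->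
       Perr theta (A delta) astar <= delta%:E /\
       Pfinite theta (A delta) = 1) /\
    (* liminf_{delta -> 0} E[N_a(tau_delta)] / E[tau_delta] >= p_a(theta) *)
    (forall (a : 'I_K) (M : R), (M < p theta a)%R ->
       \forall delta \near 0^'+,
         M%:E * Etau theta (A delta) <= ENa theta (A delta) a).

End Bandit.

(* Main.v *)
(* Change of measure without path-space martingales.  For a horizon [n] and a
   history [h] let [S_theta] be the conditional probability of stopping within
   [n] rounds in a given event, and [C] the conditional expectation of the sum of
   the Kullback-Leibler divergences of the arms pulled before stopping.  Then
   [c * S_theta - C <= ln (1 + (e^c - 1) * S_lambda)] by induction on [n]: a round
   is one Gaussian Donsker-Varadhan inequality per arm, followed by the concavity
   of [ln] over the randomization of the arm.  With [h] empty, [n] going to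
   infinity, [e^c = ((1 - delta) / delta)^2] and the event "recommend astar", this
   says that [sum_a E[N_a] (theta_a - lambda_a)^2 / 2] is at least
   [(1 - 2 delta) ln ((1 - delta) / delta)] whenever [lambda] has another best arm.
   Moving the means of [a] and [astar] to their weighted average bounds
   [1 / w_a + 1 / w_astar], where [w_a = E[N_a] / E[tau]]; fairness says that [w]
   lies in [Sigma_p], and asymptotically that it is close to [Sigma_p]. *)
Require Import Defs.
From HB Require Import structures.
From mathcomp Require Import all_boot all_order all_algebra.
From mathcomp Require Import ring lra.
From mathcomp Require Import all_classical all_reals all_analysis.
From mathcomp Require Import measurable_realfun.
Import Order.TTheory GRing.Theory Num.Theory.
Import numFieldNormedType.Exports.
Local Open Scope classical_set_scope.
Local Open Scope ring_scope.

(** * Unit-variance Gaussian laws: shifts, moments and Donsker-Varadhan *)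

Section Gaussian.
Context {R : realType}.
Implicit Types m t d : R.

Lemma integral_normal_cst m (c : \bar R) : (\int[normal_prob m 1]_x c = c)%E.
Proof.
transitivity (c * normal_prob m 1 setT)%E; last by rewrite probability_setT mule1.
exact: integral_cst.
Qed.

(** The density and the Radon-Nikodym derivative have the same integral over every measurable set,
    hence agree almost everywhere. *)
Lemma ge0_integral_normal_prob m (f : R -> \bar R) :
  (forall x, 0 <= f x)%E -> measurable_fun [set: R] f ->
  (\int[normal_prob m 1]_x f x =
   \int[@lebesgue_measure R]_x (f x * (normal_pdf m 1 x)%:E))%E.
Proof.
move=> f0 mf; have dom := normal_prob_dominates m (1 : R).
rewrite -(Radon_Nikodym_SigmaFinite.change_of_variables dom)//.
have mpdf : measurable_fun [set: R] (fun x => (normal_pdf m 1 x)%:E).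
  by apply/measurable_EFinP; exact: measurable_normal_pdf.
have iRN := Radon_Nikodym_SigmaFinite.f_integrable dom.
apply: ge0_ae_eq_integral => //.
- by apply: emeasurable_funM => //; exact: measurable_int iRN.
- exact: emeasurable_funM.
- by move=> x _; rewrite mule_ge0// Radon_Nikodym_SigmaFinite.f_ge0.
- by move=> x _; rewrite mule_ge0// lee_fin normal_pdf_ge0.
- apply: ae_eqe_mul2l => /=; apply: integral_ae_eq => // E _ mE.
  by rewrite -Radon_Nikodym_SigmaFinite.f_integral.
Qed.

(** Likelihood ratio of [N(m + d, 1)] with respect to [N(m, 1)]. *)
Definition normal_lr m d (x : R) : R := expR (d * (x - m) - d ^+ 2 / 2).

Lemma normal_pdf_shift m d x :
  normal_pdf (m + d) 1 x = normal_lr m d x * normal_pdf m 1 x.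
Proof.
rewrite !normal_pdfE ?oner_neq0// /normal_lr mulrCA; congr (_ * _).
by rewrite /normal_fun -expRD; congr expR; rewrite expr1n; field.
Qed.

Lemma measurable_normal_lr m d : measurable_fun [set: R] (normal_lr m d).
Proof.
apply: measurableT_comp => //; apply: measurable_funB => //.
by apply: measurable_funM => //; exact: measurable_funB.
Qed.

Lemma ge0_integral_normal_shift m d (f : R -> \bar R) :
  (forall x, 0 <= f x)%E -> measurable_fun [set: R] f ->
  (\int[normal_prob (m + d) 1]_x f x =
   \int[normal_prob m 1]_x (f x * (normal_lr m d x)%:E))%E.
Proof.
move=> f0 mf; rewrite [LHS](ge0_integral_normal_prob (m + d) f f0 mf).
rewrite [RHS](ge0_integral_normal_prob m); last 2 first.
- by move=> x; rewrite mule_ge0// lee_fin expR_ge0.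
- apply: emeasurable_funM => //; apply/measurable_EFinP.
  exact: measurable_normal_lr.
by apply: eq_integral => x _; rewrite normal_pdf_shift EFinM muleA.
Qed.

(** Completing the square: the integrand is [e^(t^2/2)] times the likelihood ratio of the shift by
    [t], which has integral 1. *)
Lemma normal_mgf m t :
  (\int[normal_prob m 1]_x (expR (t * (x - m)))%:E = (expR (t ^+ 2 / 2))%:E)%E.
Proof.
have H : (\int[normal_prob m 1]_x (normal_lr m t x)%:E = 1)%E.
  rewrite -[RHS](integral_normal_cst (m + t)).
  rewrite [RHS](ge0_integral_normal_shift m t (fun=> 1%E) (fun=> lee01)
    (measurable_cst _)).
  by apply: eq_integral => x _; rewrite mul1e.
transitivity (\int[normal_prob m 1]_x
    ((expR (t ^+ 2 / 2))%:E * (normal_lr m t x)%:E))%E.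
  apply: eq_integral => x _; rewrite -EFinM /normal_lr -expRD.
  by congr (expR _)%:E; ring.
rewrite ge0_integralZl//.
- by rewrite H mule1.
- by apply/measurable_EFinP; exact: measurable_normal_lr.
- by move=> x _; rewrite lee_fin expR_ge0.
Qed.

Lemma integrable_expR_normal m t :
  (normal_prob m 1).-integrable [set: R] (fun x => (expR (t * (x - m)))%:E).
Proof.
apply/integrableP; split.
  apply/measurable_EFinP/measurableT_comp => //.
  by apply: measurable_funM => //; exact: measurable_funB.
under eq_integral do rewrite gee0_abs ?lee_fin ?expR_ge0//.
by rewrite normal_mgf ltry.
Qed.

(** Domination by exponential moments: [|y| <= e^y + e^(-y)]. *)
Lemma integrable_normal_center m :
  (normal_prob m 1).-integrable [set: R] (fun x => (x - m)%:E).
Proof.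
apply: (@le_integrable _ _ R (normal_prob m 1) _ measurableT _
  (fun x : measurableTypeR R => (expR (1 * (x - m)))%:E + (expR (- 1 * (x - m)))%:E)%E).
- by apply/measurable_EFinP; exact: measurable_funB.
- move=> x _; rewrite -EFinD !abse_EFin lee_fin.
  rewrite [leRHS]ger0_norm ?addr_ge0 ?expR_ge0// mul1r mulN1r ler_norml.
  have := expR_ge1Dx (x - m); have := expR_ge1Dx (- (x - m)).
  have := expR_ge0 (x - m); have := expR_ge0 (- (x - m)).
  by move: (expR _) (expR _) => a b; lra.
- by apply: integrableD => //; exact: integrable_expR_normal.
Qed.

(** Since [e^(-y) >= 1 - y], [e^y] is at most [1 / (1 - y)], which stays below [1 + 2 y] up to
    [y = 1/2]. *)
Lemma expR_le1D2x (y : R) : 0 <= y <= 2^-1 -> expR y <= 1 + 2 * y.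
Proof.
move=> /andP[y0 y2].
have : expR y * (1 - y) <= 1.
  rewrite -[leRHS](expRxMexpNx_1 y) ler_pM2l ?expR_gt0//.
  exact: expR_ge1Dx.
have := expR_gt0 y; move: (expR y) => e e0 h.
by nra.
Qed.

(* [t * E X <= E (e^(t X)) - 1 = O(t^2)] for both signs of [t]. *)
Lemma normal_mean m : (\int[normal_prob m 1]_x (x - m)%:E = 0)%E.
Proof.
have ic := integrable_normal_center m.
have fi := integrable_fin_num measurableT ic.
rewrite -(fineK fi); congr EFin; set e := fine _.
have key t : t * e <= expR (t ^+ 2 / 2) - 1.
  rewrite -lee_fin EFinM /e fineK// -integralZl// EFinB -(normal_mgf m).
  rewrite -[1%:E](integral_normal_cst m).
  rewrite -integralB//.
  - apply: le_integral => //.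
    + exact: integrableZl.
    + apply: integrableB => //; first exact: integrable_expR_normal.
      by apply: finite_measure_integrable_cst.
    + move=> x _; rewrite -EFinM -EFinB lee_fin.
      by rewrite lerBrDl expR_ge1Dx.
  - exact: integrable_expR_normal.
  - exact: finite_measure_integrable_cst.
have e1 : 0 < 1 + `|e| by rewrite ltr_pwDl.
(* This [t] is small enough for the quadratic bound and proportional to [e]: as [e = 2 (1 + |e|) t],
   the inequality [t e <= t^2] forces [t = 0]. *)
set t := e / (2 * (1 + `|e|)).
have te : t * (2 * (1 + `|e|)) = e by rewrite /t divfK// gt_eqF// mulr_gt0.
have t1 : `|t| <= 2^-1.
  rewrite /t normrM normfV [`|_ * _|]gtr0_norm ?mulr_gt0//.
  rewrite ler_pdivrMr ?mulr_gt0//; have := normr_ge0 e; lra.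
have t2 : t ^+ 2 <= 4^-1.
  rewrite -real_normK ?num_real//; have := normr_ge0 t; nra.
have t20 := sqr_ge0 t.
have := key t.
have : expR (t ^+ 2 / 2) <= 1 + 2 * (t ^+ 2 / 2) by apply: expR_le1D2x; lra.
move: (expR _) => E hE hk.
have {hE hk} : t * e <= t ^+ 2 by lra.
rewrite -te => h.
have n0 := normr_ge0 e.
have : t ^+ 2 = 0 by nra.
by move/eqP; rewrite sqrf_eq0 => /eqP ->; rewrite mul0r.
Qed.

(** Concavity of [ln], in the form that drives Donsker-Varadhan, Jensen and the numerical bounds
    below. *)
Lemma ln_tangent (x y : R) : 0 < x -> 0 < y -> ln x <= ln y + x / y - 1.
Proof.
move=> x0 y0; rewrite -addrA -lerBlDl -ln_div//.
have := @le_ln1Dx R (x / y - 1); rewrite addrCA subrr addr0; apply.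
by rewrite ltrBDr addrC subrr divr_gt0.
Qed.

(** Apply the tangent bound at [I = E_b v] to [v] times the likelihood ratio of [b] against [a], and
    integrate under [a]: the linear term has mean [I / I - 1 = 0], and the log-likelihood ratio has
    mean [- (a - b)^2 / 2]. The bounds on [v] give integrability. *)
Lemma normal_donsker_varadhan (a b M : R) (v : R -> R) :
  measurable_fun [set: R] v -> (forall x, 1 <= v x <= M) ->
  (\int[normal_prob a 1]_x (ln (v x))%:E <=
   ((a - b) ^+ 2 / 2 + ln (fine (\int[normal_prob b 1]_x (v x)%:E)))%:E)%E.
Proof.
move=> mv vM.
have v0 x : 0 < v x by case/andP: (vM x) => h _; exact: lt_le_trans h.
have mvE : measurable_fun [set: R] (EFin \o v) by exact/measurable_EFinP.
have I1 : (1 <= \int[normal_prob b 1]_x (v x)%:E)%E.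
  rewrite -[1%E](integral_normal_cst b); apply: ge0_le_integral => //= x _.
  by rewrite lee_fin; case/andP: (vM x).
have IM : (\int[normal_prob b 1]_x (v x)%:E <= M%:E)%E.
  rewrite -[M%:E](integral_normal_cst b); apply: ge0_le_integral => //= x _.
    by rewrite lee_fin ltW.
  by rewrite lee_fin; case/andP: (vM x).
have fI : (\int[normal_prob b 1]_x (v x)%:E)%E \is a fin_num.
  by rewrite ge0_fin_numE ?(le_trans _ I1)//; exact: le_lt_trans IM (ltry _).
move: (fineK fI) I1; set I := fine _ => EI; rewrite -EI lee_fin => I1.
have I0 : 0 < I by exact: lt_le_trans I1.
pose d := b - a.
have EvI : (\int[normal_prob a 1]_x (v x * normal_lr a d x)%:E = I%:E)%E.
  have Eb : a + d = b by rewrite /d addrC subrK.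
  have v0' x : (0 <= (v x)%:E)%E by rewrite lee_fin ltW.
  rewrite EI -[in RHS]Eb [RHS](ge0_integral_normal_shift a d (EFin \o v) v0' mvE).
  by apply: eq_integral => x _; rewrite EFinM.
have iv : (normal_prob a 1).-integrable [set: R] (fun x => (v x * normal_lr a d x)%:E).
  apply/integrableP; split.
    by apply/measurable_EFinP/measurable_funM => //; exact: measurable_normal_lr.
  under eq_integral do
    rewrite gee0_abs ?lee_fin ?(mulr_ge0 (ltW (v0 _)) (expR_ge0 _))//.
  by rewrite EvI ltry.
have mlv : measurable_fun [set: R] (fun x => ln (v x)).
  exact: measurableT_comp.
have lv0 x : 0 <= ln (v x) by rewrite ln_ge0//; case/andP: (vM x).
have ilv : (normal_prob a 1).-integrable [set: R] (fun x => (ln (v x))%:E).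
  apply: (@le_integrable _ _ _ (normal_prob a 1) _ measurableT _ (cst (ln M)%:E)).
  - exact/measurable_EFinP.
  - move=> x _; rewrite !abse_EFin lee_fin; case/andP: (vM x) => h1 h2.
    have M1 := le_trans h1 h2.
    by rewrite !ger0_norm ?ln_ge0// ler_ln ?posrE// (lt_le_trans ltr01).
  - exact: finite_measure_integrable_cst.
have ic := integrable_normal_center a.
have icst (c : R) : (normal_prob a 1).-integrable [set: R] (fun=> c%:E).
  exact: finite_measure_integrable_cst.
have idc := integrableZl measurableT d ic.
have iIv := integrableZl measurableT I^-1 iv.
have ik := icst (ln I - 1 + d ^+ 2 / 2).
have EL : (\int[normal_prob a 1]_x ((ln (v x))%:E + d%:E * (x - a)%:E) =
    \int[normal_prob a 1]_x (ln (v x))%:E)%E.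
  rewrite (integralD measurableT ilv idc) (integralZl measurableT ic).
  rewrite [X in (_ + _ * X)%E](normal_mean a) mule0 adde0; reflexivity.
have ER : (\int[normal_prob a 1]_x ((I^-1)%:E * (v x * normal_lr a d x)%:E +
    (ln I - 1 + d ^+ 2 / 2)%:E) = ((a - b) ^+ 2 / 2 + ln I)%:E)%E.
  rewrite (integralD measurableT iIv ik) (integralZl measurableT iv).
  rewrite [X in (_ * X + _)%E]EvI [X in (_ + X)%E](integral_normal_cst a) -EFinM mulVf ?gt_eqF// -EFinD.
  by congr EFin; rewrite /d -sqrrN opprB; ring.
rewrite -EL -ER.
apply: (le_integral measurableT (integrableD measurableT ilv idc)
  (integrableD measurableT iIv ik)) => x _.
rewrite -!EFinM -!EFinD lee_fin.
have l0 : 0 < normal_lr a d x by exact: expR_gt0.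
have := ln_tangent _ _ (mulr_gt0 (v0 x) l0) I0.
rewrite lnM ?posrE// expRK (mulrC _ I^-1).
by move: (I^-1 * _) (ln _) (ln _) => A B C; lra.
Qed.

End Gaussian.

(** * Measurability of functions of the history *)

Section Histories.
Context {R : realType} {K : nat}.
Implicit Types (g : hist R K -> \bar R) (E : hist R K -> bool) (h : hist R K).

(* Histories carry no sigma-algebra: measurability is in the rewards, for each
   fixed sequence of arms. *)
Definition hmeas g := forall (t : nat) (s : t.-tuple 'I_K),
  measurable_fun [set: t.-tuple R] (fun rs : t.-tuple R => g (zip s rs)).

Definition hmeasb E := forall (t : nat) (s : t.-tuple 'I_K),
  measurable [set rs : t.-tuple R | E (zip s rs)].

Lemma indic_ge0 b : (0 <= Defs.indic R b)%E.
Proof. by case: b. Qed.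

Lemma indic_le1 b : (Defs.indic R b <= 1)%E.
Proof. by case: b; rewrite /Defs.indic ?lexx ?lee01. Qed.

Lemma hmeas_indic E : hmeasb E -> hmeas (fun h => Defs.indic R (E h)).
Proof.
move=> mE t s.
have -> : (fun rs : t.-tuple R => Defs.indic R (E (zip s rs))) =
    (fun rs => (\1_[set rs : t.-tuple R | E (zip s rs)] rs)%:E).
  apply/funext => rs; rewrite indicE; case: (boolP (E (zip s rs))) => Ers.
    by rewrite mem_set.
  by rewrite memNset//; exact/negP.
by apply/measurable_EFinP/measurable_indic; exact: mE.
Qed.

Lemma hmeasb_and E F : hmeasb E -> hmeasb F -> hmeasb (fun h => E h && F h).
Proof.
move=> mE mF t s; rewrite [X in measurable X](_ : _ =
  [set rs : t.-tuple R | E (zip s rs)] `&` [set rs : t.-tuple R | F (zip s rs)]).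
  by apply: measurableI; [exact: mE|exact: mF].
by apply/seteqP; split => rs /= /andP.
Qed.

Lemma hmeasb_not E : hmeasb E -> hmeasb (fun h => ~~ E h).
Proof.
move=> mE t s; rewrite [X in measurable X](_ : _ =
  ~` [set rs : t.-tuple R | E (zip s rs)]); first by apply: measurableC; exact: mE.
by apply/seteqP; split => rs /= /negP.
Qed.

Lemma measurable_rcons t :
  measurable_fun [set: t.-tuple R * R]
    (fun x : t.-tuple R * R => [tuple of rcons x.1 x.2]).
Proof.
apply/measurable_fun_tnthP => i /=.
rewrite [X in measurable_fun _ X](_ : _ = fun x : t.-tuple R * R =>
    if insub (val i) is Some j then tnth x.1 j else x.2); last first.
  apply/funext => x /=; rewrite (tnth_nth 0) /= nth_rcons size_tuple.
  case: insubP => [j -> ji|it]; first by rewrite (tnth_nth 0) ji.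
  by rewrite (negbTE it) ifT// eqn_leq [in X in _ && X]leqNgt it -ltnS ltn_ord.
case: insubP => [j _ _|_]; last exact: measurable_snd.
exact: (measurableT_comp (measurable_tnth j) measurable_fst).
Qed.

Lemma hmeas_rcons g a t (s : t.-tuple 'I_K) : hmeas g ->
  measurable_fun [set: t.-tuple R * R]
    (fun x : t.-tuple R * R => g (rcons (zip s x.1) (a, x.2))).
Proof.
move=> mg.
have := measurableT_comp (mg _ [tuple of rcons s a]) (measurable_rcons t).
apply: eq_measurable_fun => x _ /=.
by rewrite zip_rcons ?size_tuple.
Qed.

(** Unzipping [h] into arms and rewards makes this a section of a jointly measurable map. *)
Lemma hmeas_section g h a : hmeas g ->
  measurable_fun [set: R] (fun r => g (rcons h (a, r))).
Proof.
move=> mg.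
have := measurableT_comp (hmeas_rcons g a _ (map_tuple fst (in_tuple h)) mg)
  (pair1_measurable (map_tuple snd (in_tuple h))).
by apply: eq_measurable_fun => r _ /=; rewrite zip_unzip.
Qed.

Lemma hmeas_integral g m a : (forall h, 0 <= g h)%E -> hmeas g ->
  hmeas (fun h => \int[normal_prob m 1]_r g (rcons h (a, r)))%E.
Proof.
move=> g0 mg t s.
pose F (x : t.-tuple R * R) := g (rcons (zip s x.1) (a, x.2)).
have F0 x : (0 <= F x)%E by exact: g0.
exact: (@measurable_fun_fubini_tonelli_F _ _ _ _ R (normal_prob m 1) F
  (hmeas_rcons g a t s mg) F0).
Qed.

End Histories.

Lemma take_zip (S T : Type) n (s : seq S) (t : seq T) :
  take n (zip s t) = zip (take n s) (take n t).
Proof. by elim: n s t => [|n IH] [|x s] [|y t] //=; rewrite ?IH// take0. Qed.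

(** * Conditional expectations along the trajectory *)

Section Expectation.
Context {R : realType} {K : nat}.
Variables (A : algo R K).
Hypothesis vA : valid_algo A.
Implicit Types (f g : hist R K -> \bar R) (h : hist R K) (theta : 'I_K -> R).

Let pol_ge0 h a : 0 <= pol A h a.
Proof. by case: vA. Qed.

Let pol_sum h : \sum_(a < K) pol A h a = 1.
Proof. by case: vA => _ []. Qed.

Lemma hmeas_pol a : hmeas (fun h => (pol A h a)%:E).
Proof.
by move=> t s; apply/measurable_EFinP; case: vA => _ [] _ [] + _; apply.
Qed.

(** Transition operator of the history process; [ev] iterates it. *)
Definition one_step theta f h : \bar R :=
  (\sum_(a < K) (pol A h a)%:E * \int[normal_prob (theta a) 1]_r f (rcons h (a, r)))%E.

Lemma evS theta n h g :
  ev theta A n.+1 h g = one_step theta (fun h' => ev theta A n h' g) h.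
Proof. by []. Qed.

Lemma eq_one_step theta f g h : (forall x, f (rcons h x) = g (rcons h x)) ->
  one_step theta f h = one_step theta g h.
Proof.
move=> fg; apply: eq_bigr => a _; congr (_ * _)%E.
by apply: eq_integral => r _; exact: fg.
Qed.

Lemma one_step_ge0 theta f h : (forall h, 0 <= f h)%E -> (0 <= one_step theta f h)%E.
Proof.
move=> f0; apply: sume_ge0 => a _; apply: mule_ge0; first by rewrite lee_fin.
by apply: integral_ge0 => r _; exact: f0.
Qed.

Lemma hmeas_one_step theta f : (forall h, 0 <= f h)%E -> hmeas f ->
  hmeas (one_step theta f).
Proof.
move=> f0 mf t s; apply: emeasurable_sum => a; apply: emeasurable_funM.
  exact: hmeas_pol.
exact: (hmeas_integral f (theta a) a f0 mf).
Qed.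

Lemma one_stepD theta f g h : (forall h, 0 <= f h)%E -> (forall h, 0 <= g h)%E ->
  hmeas f -> hmeas g ->
  (one_step theta (fun h => f h + g h) h = one_step theta f h + one_step theta g h)%E.
Proof.
move=> f0 g0 mf mg; rewrite /one_step -big_split; apply: eq_bigr => a _ /=.
rewrite (@ge0_integralD _ _ R (normal_prob (theta a) 1) _ measurableT
  (fun r => f (rcons h (a, r))) (fun r => g (rcons h (a, r))) (fun r _ => f0 _)
  (hmeas_section f h a mf) (fun r _ => g0 _) (hmeas_section g h a mg)).
by rewrite ge0_muleDr//; apply: integral_ge0 => r _; [exact: f0|exact: g0].
Qed.

Lemma one_stepZ theta f h (c : R) : (forall h, 0 <= f h)%E -> hmeas f -> 0 <= c ->
  (one_step theta (fun h => c%:E * f h) h = c%:E * one_step theta f h)%E.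
Proof.
move=> f0 mf c0; rewrite /one_step ge0_sume_distrr; last first.
  move=> a _; apply: mule_ge0; first by rewrite lee_fin.
  by apply: integral_ge0 => r _; exact: f0.
apply: eq_bigr => a _; rewrite muleCA; congr (_ * _)%E.
rewrite -(@ge0_integralZl _ _ R (normal_prob (theta a) 1) _ measurableT
  (fun r => f (rcons h (a, r))) (hmeas_section f h a mf) c%:E (fun r _ => f0 _))//.
Qed.

Lemma one_step_cst theta (c : R) h : one_step theta (fun=> c%:E) h = c%:E.
Proof.
rewrite /one_step; under eq_bigr do rewrite integral_normal_cst -EFinM.
by rewrite sumEFin -mulr_suml pol_sum mul1r.
Qed.

Lemma le_one_step theta f g h : (forall h, 0 <= f h)%E -> hmeas f -> hmeas g ->
  (forall h, f h <= g h)%E -> (one_step theta f h <= one_step theta g h)%E.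
Proof.
move=> f0 mf mg fg; apply: lee_sum => a _; apply: lee_wpmul2l.
  by rewrite lee_fin.
by apply: (@ge0_le_integral _ _ R (normal_prob (theta a) 1) _ measurableT
  (fun r => f (rcons h (a, r))) (fun r => g (rcons h (a, r))) (fun r _ => f0 _)
  (hmeas_section f h a mf) (hmeas_section g h a mg)) => r _; exact: fg.
Qed.

(** Only histories of the length reached after [n] rounds matter, which lets a time index be read
    off the size of the history. *)
Lemma eq_ev theta n h f g : (forall h', size h' = (size h + n)%N -> f h' = g h') ->
  ev theta A n h f = ev theta A n h g.
Proof.
elim: n h => [|n IH] h fg; first by apply: fg; rewrite addn0.
rewrite !evS; apply: eq_one_step => x; apply: IH => h' h'E.
by apply: fg; rewrite h'E size_rcons addnS addSn.
Qed.

Lemma ev_ge0 theta n h g : (forall h, 0 <= g h)%E -> (0 <= ev theta A n h g)%E.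
Proof.
move=> g0; elim: n h => [|n IH] h; first exact: g0.
by rewrite evS; apply: one_step_ge0.
Qed.

Lemma hmeas_ev theta n g : (forall h, 0 <= g h)%E -> hmeas g ->
  hmeas (fun h => ev theta A n h g).
Proof.
move=> g0 mg; elim: n => [//|n IH].
by apply: (hmeas_one_step theta (fun h => ev theta A n h g)) => // h; exact: ev_ge0.
Qed.

Lemma ev_tower theta m n h g :
  ev theta A (m + n) h g = ev theta A m h (fun h' => ev theta A n h' g).
Proof.
elim: m h => [//|m IH] h; rewrite addSn !evS.
by apply: eq_one_step => x; rewrite IH.
Qed.

Lemma evD theta n h f g : (forall h, 0 <= f h)%E -> (forall h, 0 <= g h)%E ->
  hmeas f -> hmeas g ->
  (ev theta A n h (fun h => f h + g h) = ev theta A n h f + ev theta A n h g)%E.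
Proof.
move=> f0 g0 mf mg; elim: n h => [//|n IH] h; rewrite !evS.
rewrite -one_stepD; last 4 first.
- by move=> ?; exact: ev_ge0.
- by move=> ?; exact: ev_ge0.
- exact: hmeas_ev.
- exact: hmeas_ev.
by apply: eq_one_step => x; exact: IH.
Qed.

Lemma evZ theta n h (c : R) g : (forall h, 0 <= g h)%E -> hmeas g -> 0 <= c ->
  (ev theta A n h (fun h => c%:E * g h) = c%:E * ev theta A n h g)%E.
Proof.
move=> g0 mg c0; elim: n h => [//|n IH] h; rewrite !evS.
rewrite -one_stepZ//; last 2 first.
- by move=> ?; exact: ev_ge0.
- exact: hmeas_ev.
by apply: eq_one_step => x; exact: IH.
Qed.

Lemma ev_sum theta n h I (r : seq I) (f : I -> hist R K -> \bar R) :
  (forall i h, 0 <= f i h)%E -> (forall i, hmeas (f i)) ->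
  (ev theta A n h (fun h => \sum_(i <- r) f i h) =
   \sum_(i <- r) ev theta A n h (f i))%E.
Proof.
move=> f0 mf; elim: r => [|i r IH].
  rewrite big_nil (eq_ev _ _ _ _ (fun=> 0%:E)); last by move=> ? _; rewrite big_nil.
  elim: n h => [//|n IHn] h; rewrite evS (eq_one_step _ _ (fun=> 0%:E)).
    exact: one_step_cst.
  by move=> x; exact: IHn.
rewrite big_cons -IH -evD//; first by apply: eq_ev => h' _; rewrite big_cons.
  by move=> h'; apply: sume_ge0.
by move=> t s; apply: emeasurable_sum => j; exact: mf.
Qed.

(** The state [h] itself is counted; the one reached after [n] rounds is not. *)
Definition cumul theta n g h : \bar R := (\sum_(k < n) ev theta A k h g)%E.

Lemma cumul_ge0 theta n g h : (forall h, 0 <= g h)%E -> (0 <= cumul theta n g h)%E.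
Proof. by move=> g0; apply: sume_ge0 => k _; exact: ev_ge0. Qed.

Lemma hmeas_cumul theta n g : (forall h, 0 <= g h)%E -> hmeas g ->
  hmeas (cumul theta n g).
Proof.
by move=> g0 mg t s; apply: emeasurable_sum => k; exact: hmeas_ev.
Qed.

Lemma cumul_recr theta n g h :
  (cumul theta n.+1 g h = cumul theta n g h + ev theta A n h g)%E.
Proof. exact: big_ord_recr. Qed.

(** The defining sum grows at its last round; linearity of [one_step] turns this into a first-step
    decomposition, on which the inductions over the horizon rest. *)
Lemma cumulS theta n g h : (forall h, 0 <= g h)%E -> hmeas g ->
  (cumul theta n.+1 g h = g h + one_step theta (cumul theta n g) h)%E.
Proof.
move=> g0 mg; elim: n => [|n IH].
  rewrite /cumul big_ord_recl big_ord0 (eq_one_step _ _ (fun=> 0%:E)).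
    by rewrite one_step_cst.
  by move=> x; rewrite big_ord0.
rewrite cumul_recr IH -addeA; congr (_ + _)%E.
rewrite evS -one_stepD.
- by apply: eq_one_step => x; rewrite cumul_recr.
- by move=> ?; exact: cumul_ge0.
- by move=> ?; exact: ev_ge0.
- exact: hmeas_cumul.
- exact: hmeas_ev.
Qed.

(** Here and in [stopped_now], reading the time off the length of the history removes the round
    index, so that one function serves all rounds of [cumul]. *)
Definition alive h := not_stopped_upto A (size h) h.

Definition stopped_now h := stops_at A (size h) h.

Lemma not_stopped_uptoP n h :
  reflect (forall s, (s <= n)%N -> ~~ stp A (take s h)) (not_stopped_upto A n h).
Proof.
apply: (iffP forallP) => [H s sn|H [s sn]]; last exact: H.
by have := H (Ordinal (sn : (s < n.+1)%N)).
Qed.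

Lemma not_stopped_uptoS n h :
  not_stopped_upto A n.+1 h = not_stopped_upto A n h && ~~ stp A (take n.+1 h).
Proof.
apply/not_stopped_uptoP/andP => [H|[/not_stopped_uptoP H Hn] s].
  by split; [apply/not_stopped_uptoP => s sn; exact/H/leqW|exact: H].
by rewrite leq_eqVlt => /predU1P[->|]; [|exact: H].
Qed.

Lemma not_stopped_upto_rcons h x :
  not_stopped_upto A (size h) (rcons h x) = alive h.
Proof.
by apply/not_stopped_uptoP/not_stopped_uptoP => H s sh; have := H s sh;
  rewrite -cats1 takel_cat.
Qed.

Lemma alive_rcons h x : alive (rcons h x) = alive h && ~~ stp A (rcons h x).
Proof.
rewrite /alive size_rcons not_stopped_uptoS not_stopped_upto_rcons.
by rewrite -(size_rcons h x) take_size.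
Qed.

Lemma stopped_now_rcons h x :
  stopped_now (rcons h x) = stp A (rcons h x) && alive h.
Proof.
rewrite /stopped_now /stops_at size_rcons -[X in _ && X]/(not_stopped_upto A _ _).
by rewrite not_stopped_upto_rcons -(size_rcons h x) take_size.
Qed.

Lemma stopped_now_alive h : alive h -> stopped_now h = false.
Proof.
move=> /not_stopped_uptoP H; apply/negbTE.
by rewrite negb_and H.
Qed.

Lemma hmeasb_stp n : hmeasb (fun h => stp A (take n h)).
Proof.
move=> t s; case: vA => _ [] _ [] _ [] mS _.
have mt : measurable_fun [set: t.-tuple R] (fun rs : t.-tuple R => [tuple of take n rs]).
  apply/measurable_fun_tnthP => i.
  have it : (i < t)%N by rewrite (leq_trans (ltn_ord i))// geq_minr.
  rewrite [X in measurable_fun _ X](_ : _ = fun rs : t.-tuple R => tnth rs (Ordinal it)).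
    exact: measurable_tnth.
  apply/funext => rs /=; rewrite !(tnth_nth 0) /= nth_take//.
  by rewrite (leq_trans (ltn_ord i))// geq_minl.
have := mt measurableT _ (mS _ [tuple of take n s]); rewrite setTI.
rewrite [X in measurable X -> _](_ : _ = [set rs : t.-tuple R | stp A (take n (zip s rs))])//.
by apply/seteqP; split => rs /=; rewrite take_zip.
Qed.

Lemma hmeasb_not_stopped_upto n : hmeasb (not_stopped_upto A n).
Proof.
elim: n => [|n IH] t s.
  rewrite [X in measurable X](_ : _ = [set rs : t.-tuple R | ~~ stp A (take 0 (zip s rs))]).
    exact: (hmeasb_not _ (hmeasb_stp 0)).
  apply/seteqP; split => rs /=; first by move=> /not_stopped_uptoP; apply.
  by move=> H; apply/not_stopped_uptoP => -[].
under eq_set do rewrite not_stopped_uptoS.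
exact: (hmeasb_and _ _ IH (hmeasb_not _ (hmeasb_stp n.+1))).
Qed.

Lemma hmeasb_stops_at n : hmeasb (stops_at A n).
Proof.
case: n => [|n]; last first.
  exact: (hmeasb_and _ _ (hmeasb_stp n.+1) (hmeasb_not_stopped_upto n)).
move=> t s; rewrite [X in measurable X](_ : _ =
    [set rs : t.-tuple R | stp A (take 0 (zip s rs))]); first exact: hmeasb_stp.
apply/seteqP; split => rs /=; first by case/andP.
by move=> H; apply/andP; split=> //; apply/forallP => -[].
Qed.

Lemma hmeasb_dec b : hmeasb (fun h => dec A h == b).
Proof.
move=> t s; case: vA => _ [] _ [] _ [] _ mD.
rewrite [X in measurable X](_ : _ = [set rs : t.-tuple R | dec A (zip s rs) = b]).
  exact: mD.
by apply/seteqP; split => rs /= /eqP.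
Qed.

Lemma hmeasb_size (E : nat -> hist R K -> bool) :
  (forall n, hmeasb (E n)) -> hmeasb (fun h => E (size h) h).
Proof.
move=> mE t s.
rewrite [X in measurable X](_ : _ = [set rs : t.-tuple R | E t (zip s rs)]).
  exact: mE.
by apply/seteqP; split => rs /=; rewrite size_zip !size_tuple minnn.
Qed.

(** * Change of measure up to the stopping time *)

Definition gauss_kl theta (lambda : 'I_K -> R) (b : 'I_K) : R :=
  (theta b - lambda b) ^+ 2 / 2.

Lemma gauss_kl_ge0 theta lambda b : 0 <= gauss_kl theta lambda b.
Proof. by rewrite mulr_ge0// sqr_ge0. Qed.

Definition stop_in (Q : hist R K -> bool) h : \bar R :=
  Defs.indic R (stopped_now h && Q h).

(** The arm pulled next is averaged out, which makes the cost a function of the past alone. *)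
Definition round_cost (kl : 'I_K -> R) h : \bar R :=
  ((\sum_(b < K) pol A h b * kl b)%:E * Defs.indic R (alive h))%E.

Lemma stop_in_ge0 Q h : (0 <= stop_in Q h)%E.
Proof. exact: indic_ge0. Qed.

Lemma hmeas_stop_in Q : hmeasb Q -> hmeas (stop_in Q).
Proof.
move=> mQ; apply: hmeas_indic; apply: (hmeasb_and _ _ _ mQ).
exact: (hmeasb_size _ hmeasb_stops_at).
Qed.

Lemma hmeas_alive : hmeas (fun h => Defs.indic R (alive h)).
Proof. exact: (hmeas_indic _ (hmeasb_size _ hmeasb_not_stopped_upto)). Qed.

Section Cost.
Variable kl : 'I_K -> R.
Hypothesis kl_ge0 : forall b, 0 <= kl b.

Lemma round_cost_ge0 h : (0 <= round_cost kl h)%E.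
Proof.
rewrite mule_ge0// ?indic_ge0// lee_fin sumr_ge0// => b _.
by rewrite mulr_ge0.
Qed.

Lemma round_costE h : (round_cost kl h =
  \sum_(b < K) (kl b)%:E * ((pol A h b)%:E * Defs.indic R (alive h)))%E.
Proof.
rewrite /round_cost -sumEFin ge0_sume_distrl => [|b _]; last first.
  by rewrite lee_fin mulr_ge0.
by apply: eq_bigr => b _; rewrite EFinM muleA (muleC (kl b)%:E).
Qed.

Lemma hmeas_round_cost : hmeas (round_cost kl).
Proof.
rewrite (funext round_costE) => t s.
apply: emeasurable_sum => b; apply: emeasurable_funM => //.
by apply: emeasurable_funM; [exact: hmeas_pol|exact: hmeas_alive].
Qed.

End Cost.

Section Dead.
Variable g : hist R K -> \bar R.
Hypotheses (g_ge0 : forall h, (0 <= g h)%E) (mg : hmeas g).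
Hypothesis g_dead : forall h x, ~~ alive h -> g (rcons h x) = 0%E.

(** The hypothesis [g_dead] speaks of strict extensions only: the history at which the algorithm
    stops is itself not alive, yet [stop_in] may be 1 there. *)
Lemma cumul_dead theta n h x : ~~ alive h -> cumul theta n g (rcons h x) = 0%E.
Proof.
elim: n h x => [|n IH] h x dh; first by rewrite /cumul big_ord0.
rewrite cumulS// g_dead// add0e (eq_one_step _ _ (fun=> 0%:E)) ?one_step_cst//.
by move=> y; rewrite IH// alive_rcons (negbTE dh).
Qed.

Lemma cumulS_dead theta n h : ~~ alive h -> cumul theta n.+1 g h = g h.
Proof.
move=> dh; rewrite cumulS// (eq_one_step _ _ (fun=> 0%:E)).
  by rewrite one_step_cst adde0.
by move=> y; exact: cumul_dead.
Qed.

End Dead.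

Lemma stop_in_dead Q h x : ~~ alive h -> stop_in Q (rcons h x) = 0%E.
Proof. by move=> dh; rewrite /stop_in stopped_now_rcons (negbTE dh) andbF. Qed.

Lemma round_cost_dead kl h : ~~ alive h -> round_cost kl h = 0%E.
Proof. by move=> dh; rewrite /round_cost (negbTE dh) mule0. Qed.

(** Stopping happens at most once: an alive history contributes nothing in the current round, any
    other history nothing afterwards. *)
Lemma cumul_stop_in_le1 theta n Q h : hmeasb Q -> (cumul theta n (stop_in Q) h <= 1)%E.
Proof.
move=> mQ; elim: n h => [|n IH] h; first by rewrite /cumul big_ord0 lee01.
have [ah|dh] := boolP (alive h); last first.
  rewrite cumulS_dead ?indic_le1//; [exact: stop_in_ge0|exact: hmeas_stop_in|].
  exact: stop_in_dead.
rewrite cumulS; [|exact: stop_in_ge0|exact: hmeas_stop_in].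
rewrite {1}/stop_in stopped_now_alive// add0e -(one_step_cst theta 1 h).
apply: le_one_step => //.
- by move=> ?; apply: cumul_ge0; exact: stop_in_ge0.
- by apply: hmeas_cumul; [exact: stop_in_ge0|exact: hmeas_stop_in].
Qed.

(** Average the tangent bounds at the mean [y]; the linear terms cancel. *)
Lemma ln_jensen (w m : 'I_K -> R) : (forall a, 0 <= w a) -> \sum_a w a = 1 ->
  (forall a, 1 <= m a) -> \sum_a w a * ln (m a) <= ln (\sum_a w a * m a).
Proof.
move=> w0 w1 m1; set y := \sum_a w a * m a.
have y1 : 1 <= y.
  by rewrite -w1; apply: ler_sum => a _; rewrite -{1}(mulr1 (w a)) ler_wpM2l.
have y0 : 0 < y by exact: lt_le_trans y1.
have -> : ln y = \sum_a w a * (ln y + m a / y - 1).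
  under eq_bigr do rewrite -addrA mulrDr mulrBr mulr1 mulrA.
  by rewrite big_split sumrB -!mulr_suml w1 mul1r /= -/y divff ?gt_eqF// subrr addr0.
apply: ler_sum => a _; rewrite ler_wpM2l// ln_tangent//.
exact: lt_le_trans (m1 a).
Qed.

(* Conditioned on the history [h], the right-hand side is the relative entropy
   of the rest of the experiment plus the logarithmic moment generating function
   of the indicator of the event under [lambda]. *)
Lemma stopped_donsker_varadhan theta lambda (c : R) Q n h : 0 <= c -> hmeasb Q ->
  (c%:E * cumul theta n (stop_in Q) h <=
   cumul theta n (round_cost (gauss_kl theta lambda)) h +
   (ln (1 + (expR c - 1) * fine (cumul lambda n (stop_in Q) h)))%:E)%E.
Proof.
move=> c0 mQ; pose kl := gauss_kl theta lambda; rewrite -/kl.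
have kl0 : forall b, 0 <= kl b by exact: gauss_kl_ge0.
have ec1 : 1 <= expR c by rewrite -expR0 ler_expR.
have g0 := stop_in_ge0 Q; have mg := hmeas_stop_in Q mQ.
have k0 := round_cost_ge0 kl kl0; have mk := hmeas_round_cost kl kl0.
elim: n h => [|n IH] h.
  by rewrite /cumul !big_ord0 mule0 add0e lee_fin mulr0 addr0 ln1.
(* Once stopped, no cost remains and equality holds, since [ln (1 + (e^c - 1)) = c]. *)
have [ah|dh] := boolP (alive h); last first.
  rewrite !cumulS_dead//; first last.
  - exact: stop_in_dead.
  - by move=> h0 x dh0; rewrite round_cost_dead// alive_rcons (negbTE dh0).
  - exact: stop_in_dead.
  rewrite (round_cost_dead _ _ dh) add0e /stop_in; case: (_ && _) => /=.
    by rewrite mule1 lee_fin mulr1 subrKC expRK.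
  by rewrite mule0 lee_fin mulr0 addr0 ln1.
have sz : stop_in Q h = 0%E by rewrite /stop_in stopped_now_alive.
have E th : cumul th n.+1 (stop_in Q) h = one_step th (cumul th n (stop_in Q)) h.
  by rewrite cumulS// sz add0e.
rewrite !E (cumulS theta n _ h k0 mk) {1}/round_cost ah mule1.
pose S a r := cumul lambda n (stop_in Q) (rcons h (a, r)).
(* The argument of the logarithm one round later; it lies in [[1, e^c]], as Donsker-Varadhan
   requires. *)
pose V a r := 1 + (expR c - 1) * fine (S a r).
have S0 a r : (0 <= S a r)%E by apply: cumul_ge0.
have S1 a r : (S a r <= 1)%E by exact: cumul_stop_in_le1.
have Sfin a r : S a r \is a fin_num.
  by rewrite ge0_fin_numE//; exact: le_lt_trans (S1 a r) (ltry _).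
have mS a : measurable_fun [set: R] (S a).
  by apply: (hmeas_section (cumul lambda n (stop_in Q))); exact: hmeas_cumul.
have mV a : measurable_fun [set: R] (V a).
  apply: measurable_funD => //; apply: measurable_funM => //.
  exact: (measurableT_comp _ (mS a)).
have mlnV a : measurable_fun [set: R] (fun r => (ln (V a r))%:E).
  by apply/measurable_EFinP; exact: (measurableT_comp (@measurable_ln R) (mV a)).
have V1 a r : 1 <= V a r <= expR c.
  have s0 := fine_ge0 (S0 a r).
  have s1 : fine (S a r) <= 1 by rewrite -lee_fin fineK.
  by rewrite /V; move: (fine _) (expR c) s0 s1 ec1 => s e; nra.
pose I a := fine (\int[normal_prob (lambda a) 1]_r S a r).
have I0 a : (0 <= \int[normal_prob (lambda a) 1]_r S a r)%E by exact: integral_ge0.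
have Ifin a : (\int[normal_prob (lambda a) 1]_r S a r)%E \is a fin_num.
  rewrite ge0_fin_numE//; apply: (@le_lt_trans _ _ 1%E); last exact: ltry.
  rewrite -[leRHS](integral_normal_cst (lambda a)).
  apply: (@ge0_le_integral _ _ R (normal_prob (lambda a) 1) _ measurableT
    (S a) (fun=> 1%E) (fun r _ => S0 a r) (mS a) (measurable_cst _)) => r _.
  exact: S1.
have IV a : (\int[normal_prob (lambda a) 1]_r (V a r)%:E =
    (1 + (expR c - 1) * I a)%:E)%E.
  transitivity (\int[normal_prob (lambda a) 1]_r (1 + (expR c - 1)%:E * S a r))%E.
    by apply: eq_integral => r _; rewrite /V EFinD EFinM fineK.
  rewrite (@ge0_integralD _ _ R (normal_prob (lambda a) 1) _ measurableT
    (fun=> 1%E) (fun r => (expR c - 1)%:E * S a r)%E).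
  - rewrite [X in (X + _)%E](integral_normal_cst (lambda a)).
    rewrite (@ge0_integralZl _ _ R (normal_prob (lambda a) 1) _ measurableT
      (S a) (mS a) (expR c - 1)%:E (fun r _ => S0 a r)) ?lee_fin ?subr_ge0//.
    by rewrite -[X in (_ + _ * X)%E](fineK (Ifin a)) -EFinM -EFinD.
  - by [].
  - exact: measurable_cst.
  - by move=> r _; rewrite mule_ge0// lee_fin subr_ge0.
  - by apply: emeasurable_funM => //; exact: mS.
have -> : (one_step lambda (cumul lambda n (stop_in Q)) h =
    (\sum_(a < K) pol A h a * I a)%:E)%E.
  by rewrite -sumEFin; apply: eq_bigr => a _; rewrite EFinM fineK.
rewrite -one_stepZ//; last 2 first.
- by move=> ?; exact: cumul_ge0.
- exact: hmeas_cumul.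
have -> : 1 + (expR c - 1) * fine (\sum_(a < K) pol A h a * I a)%:E =
    \sum_(a < K) pol A h a * (1 + (expR c - 1) * I a).
  rewrite /= -[X in X + _](pol_sum h) mulr_sumr -big_split /=.
  by apply: eq_bigr => a _; ring.
have I00 a : 0 <= I a by exact: fine_ge0.
(* The argument of the logarithm is a mixture over the arms; Jensen reduces the claim to one
   inequality per arm. *)
have J := ln_jensen (pol A h) (fun a => 1 + (expR c - 1) * I a) (pol_ge0 h) (pol_sum h).
have J1 a : 1 <= 1 + (expR c - 1) * I a by rewrite lerDl mulr_ge0// subr_ge0.
have {}J := J J1; rewrite -lee_fin in J.
apply: (le_trans _ (leeD (lexx _) J)).
rewrite addeAC -EFinD -big_split -sumEFin /one_step -big_split /=.
apply: lee_sum => a _; rewrite -mulrDr EFinM -ge0_muleDr//; last 2 first.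
- by rewrite lee_fin addr_ge0// ln_ge0.
- by apply: integral_ge0 => r _; exact: cumul_ge0.
apply: lee_wpmul2l; first by rewrite lee_fin.
rewrite [leRHS]addeC.
(* For a fixed arm, the induction hypothesis is integrated over the reward; changing the reward law
   inside the logarithm then costs [kl a]. *)
apply: (@le_trans _ _ (\int[normal_prob (theta a) 1]_r
    (cumul theta n (round_cost kl) (rcons h (a, r)) + (ln (V a r))%:E))%E).
  apply: (@ge0_le_integral _ _ R (normal_prob (theta a) 1) _ measurableT).
  - by move=> r _; rewrite mule_ge0//; exact: cumul_ge0.
  - apply: emeasurable_funM => //.
    by apply: (hmeas_section (cumul theta n (stop_in Q))); exact: hmeas_cumul.
  - apply: emeasurable_funD.
      by apply: (hmeas_section (cumul theta n (round_cost kl))); exact: hmeas_cumul.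
    exact: mlnV.
  - by move=> r _; exact: IH.
rewrite (@ge0_integralD _ _ R (normal_prob (theta a) 1) _ measurableT).
- have DV := normal_donsker_varadhan (theta a) (lambda a) (expR c) (V a) (mV a) (V1 a).
  rewrite [X in fine X]IV in DV.
  exact: (leeD (lexx _) DV).
- by move=> r _; exact: cumul_ge0.
- by apply: (hmeas_section (cumul theta n (round_cost kl))); exact: hmeas_cumul.
- by move=> r _; rewrite lee_fin ln_ge0//; case/andP: (V1 a r).
- exact: mlnV.
Qed.

End Expectation.

(** * Lower bound on the information collected before stopping *)

Section Transportation.
Context {R : realType} {K : nat}.
Variable A : algo R K.
Hypothesis vA : valid_algo A.
Implicit Types (theta lambda : 'I_K -> R) (b : 'I_K) (n : nat).

Let pol_ge0 h a : 0 <= pol A h a.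
Proof. by case: vA. Qed.

Let pull_ge0 b h : (0 <= (pol A h b)%:E * Defs.indic R (alive A h))%E.
Proof. by rewrite mule_ge0 ?indic_ge0// lee_fin. Qed.

Let hmeas_pull b : hmeas (fun h => (pol A h b)%:E * Defs.indic R (alive A h))%E.
Proof.
move=> t s; apply: emeasurable_funM; first exact: hmeas_pol.
exact: (hmeas_alive A vA t s).
Qed.

Lemma Pn_ge0 theta n E : (0 <= Pn theta A n E)%E.
Proof. by apply: ev_ge0 => // h; exact: indic_ge0. Qed.

Lemma EtauE theta : (Etau theta A =
  \sum_(0 <= n <oo) ev theta A n [::] (fun h => Defs.indic R (alive A h)))%E.
Proof.
by apply: eq_eseriesr => n _; apply: eq_ev => h hn; rewrite /alive hn.
Qed.

(** Given the history of length [n], the next pull is integrated out, and only the term of arm [b]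
    survives in the transition sum. *)
Lemma ENaE theta b : (ENa theta A b = \sum_(0 <= n <oo)
  ev theta A n [::] (fun h => (pol A h b)%:E * Defs.indic R (alive A h)))%E.
Proof.
apply: eq_eseriesr => n _; rewrite /Pn -addn1 ev_tower; apply: eq_ev => h hn.
rewrite evS /one_step (bigD1 b)//= [X in (_ + X)%E]big1 ?adde0.
  congr (_ * _)%E; rewrite -[RHS](integral_normal_cst (theta b)).
  apply: eq_integral => r _; congr Defs.indic.
  rewrite -cats1 take_size_cat// /pulled_at drop_size_cat// eqxx andbT.
  by rewrite /alive hn.
move=> a ab; rewrite -[X in (_ * X)%E](_ : 0%E = _) ?mule0//.
rewrite -[LHS](integral_normal_cst (theta a)).
apply: eq_integral => r _.
by rewrite -cats1 /pulled_at drop_size_cat// (negbTE ab) andbF.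
Qed.

Lemma sum_ENa theta : (\sum_(b < K) ENa theta A b = Etau theta A)%E.
Proof.
rewrite EtauE; under eq_bigr do rewrite ENaE.
rewrite -nneseries_sum; last by move=> b n _; exact: ev_ge0.
apply: eq_eseriesr => n _; rewrite -ev_sum//; apply: eq_ev => h _.
rewrite -ge0_sume_distrl => [|b _]; last by rewrite lee_fin.
by rewrite sumEFin; case: vA => _ [] -> _; rewrite mul1e.
Qed.

Definition Pdec theta b : \bar R :=
  (\sum_(0 <= n <oo) Pn theta A n (fun h => stops_at A n h && (dec A h == b)))%E.

Lemma PdecE theta b : (Pdec theta b =
  \sum_(0 <= n <oo) ev theta A n [::] (stop_in A (fun h => dec A h == b)))%E.
Proof.
by apply: eq_eseriesr => n _; apply: eq_ev => h hn; rewrite /stop_in /stopped_now hn.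
Qed.

Lemma Pfinite_split theta b : (Pfinite theta A = Perr theta A b + Pdec theta b)%E.
Proof.
rewrite -nneseriesD; [|by move=> n _ _; exact: Pn_ge0|by move=> n _ _; exact: Pn_ge0].
apply: eq_eseriesr => n _; rewrite /Pn -evD//.
- apply: eq_ev => h _; case: (stops_at A n h) => /=; last by rewrite adde0.
  by case: (_ == _); rewrite ?adde0 ?add0e.
- by move=> h; exact: indic_ge0.
- by move=> h; exact: indic_ge0.
- apply: hmeas_indic; apply: hmeasb_and; first exact: hmeasb_stops_at.
  by apply: hmeasb_not; exact: hmeasb_dec.
- apply: hmeas_indic; apply: hmeasb_and; first exact: hmeasb_stops_at.
  exact: hmeasb_dec.
Qed.

Lemma Pdec_le_Perr lambda b b' : b' != b -> (Pdec lambda b <= Perr lambda A b')%E.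
Proof.
move=> bb; apply: lee_nneseries => [n _ _|n _]; first exact: Pn_ge0.
have -> : Pn lambda A n (fun h => stops_at A n h && (dec A h != b')) =
   (Pn lambda A n (fun h => stops_at A n h && (dec A h == b)) +
    Pn lambda A n (fun h => [&& stops_at A n h, dec A h != b' & dec A h != b]))%E.
  rewrite /Pn -evD//.
  - apply: eq_ev => h _; case: (stops_at A n h) => /=; last by rewrite adde0.
    have [->|_] := eqVneq (dec A h) b.
      by rewrite eq_sym bb adde0.
    by rewrite andbT add0e.
  - by move=> h; exact: indic_ge0.
  - by move=> h; exact: indic_ge0.
  - apply: hmeas_indic; apply: hmeasb_and; first exact: hmeasb_stops_at.
    exact: hmeasb_dec.
  - apply: hmeas_indic; apply: hmeasb_and; first exact: hmeasb_stops_at.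
    by apply: hmeasb_and; apply: hmeasb_not; exact: hmeasb_dec.
by rewrite leeDl// Pn_ge0.
Qed.

Lemma cumul_round_cost theta (kl : 'I_K -> R) n : (forall b, 0 <= kl b) ->
  (cumul A theta n (round_cost A kl) [::] <= \sum_(b < K) (kl b)%:E * ENa theta A b)%E.
Proof.
move=> kl0; rewrite /cumul (funext (round_costE A vA kl kl0)).
pose f b h := ((pol A h b)%:E * Defs.indic R (alive A h))%E.
have evf k b : (0 <= ev theta A k [::] (f b))%E.
  by apply: ev_ge0 => // h; exact: pull_ge0.
rewrite (eq_bigr (fun k : 'I_n => \sum_(b < K) (kl b)%:E * ev theta A k [::] (f b))%E).
  2:{ move=> k _; rewrite (ev_sum A vA).
  - by apply: eq_bigr => b _; rewrite (evZ A vA).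
  - by move=> b h; rewrite mule_ge0// lee_fin.
  - by move=> b t s; apply: emeasurable_funM => //; exact: hmeas_pull. }
rewrite exchange_big; apply: lee_sum => b _ /=.
rewrite -ge0_sume_distrr => [|k _]; last exact: evf.
apply: lee_wpmul2l; first by rewrite lee_fin.
rewrite ENaE -(big_mkord xpredT (fun k => ev theta A k [::] _)).
by apply: nneseries_lim_ge => k _ _; exact: evf.
Qed.

(** The right-hand side dominates the finite-horizon one for every [n], so only the left-hand side
    is passed to the limit. *)
Lemma transportation theta lambda (c d : R) b : 0 <= c ->
  (Pdec lambda b <= d%:E)%E ->
  (c%:E * Pdec theta b <= \sum_(a < K) (gauss_kl theta lambda a)%:E * ENa theta A a +
    (ln (1 + (expR c - 1) * d))%:E)%E.
Proof.
move=> c0 hd; have ec : 1 <= expR c by rewrite -expR0 ler_expR.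
have s0 h : (0 <= stop_in A (fun h => dec A h == b) h)%E by exact: indic_ge0.
have mQ := hmeasb_dec A vA b.
rewrite PdecE -nneseriesZl; last by move=> n _; exact: ev_ge0.
apply: lime_le.
  by apply: is_cvg_nneseries => n _ _; rewrite mule_ge0 ?lee_fin//; exact: ev_ge0.
apply: nearW => n; rewrite -ge0_sume_distrr => [|k _]; last exact: ev_ge0.
rewrite big_mkord.
apply: (le_trans (stopped_donsker_varadhan A vA theta lambda c _ n [::] c0 mQ)).
apply: leeD; first by apply: cumul_round_cost => a; exact: gauss_kl_ge0.
have S0 : (0 <= cumul A lambda n (stop_in A (fun h => dec A h == b)) [::])%E.
  exact: cumul_ge0.
have Sd : (cumul A lambda n (stop_in A (fun h => dec A h == b)) [::] <= d%:E)%E.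
  apply: le_trans hd; rewrite PdecE /cumul.
  rewrite -(big_mkord xpredT (fun k => ev lambda A k [::] _)).
  by apply: nneseries_lim_ge => k _ _; exact: ev_ge0.
have fS : fine (cumul A lambda n (stop_in A (fun h => dec A h == b)) [::]) <= d.
  rewrite -lee_fin fineK// ge0_fin_numE//; exact: le_lt_trans Sd (ltry _).
have fS0 := fine_ge0 S0.
have e0 : 0 <= expR c - 1 by rewrite subr_ge0.
rewrite lee_fin ler_ln ?posrE.
- by rewrite lerD2l ler_wpM2l.
- by rewrite ltr_pwDl// mulr_ge0.
- by rewrite ltr_pwDl// mulr_ge0// (le_trans fS0).
Qed.

Lemma kl_lower_bound theta lambda (delta : R) b b' :
  0 < delta < 2^-1 -> b' != b -> Pfinite theta A = 1%E ->
  (Perr theta A b <= delta%:E)%E -> (Perr lambda A b' <= delta%:E)%E ->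
  (((1 - 2 * delta) * ln ((1 - delta) / delta))%:E <=
   \sum_(a < K) (gauss_kl theta lambda a)%:E * ENa theta A a)%E.
Proof.
move=> /andP[d0 d2] bb fin err err'.
have d1 : 0 < 1 - delta by lra.
set q := (1 - delta) / delta.
have q1 : 1 <= q by rewrite /q ler_pdivlMr//; lra.
have q0 : 0 < q by exact: lt_le_trans q1.
have lq : 0 <= ln q by exact: ln_ge0.
have c0 : 0 <= ln q + ln q by exact: addr_ge0.
have := transportation theta lambda _ _ b c0 (le_trans (Pdec_le_Perr lambda b b' bb) err').
rewrite expRD.
(* With [c = 2 ln q] the logarithm collapses to [ln q], and [2 (1 - delta) ln q - ln q = (1 - 2
   delta) ln q] is the relative entropy between the Bernoulli laws of parameters [delta] and
   [1 - delta]. *)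
have -> : 1 + (expR (ln q) * expR (ln q) - 1) * delta = q.
  by rewrite lnK ?posrE// /q; field; rewrite gt_eqF.
have : ((1 - delta)%:E <= Pdec theta b)%E.
  rewrite EFinB -fin (Pfinite_split theta b) leeBlDr//.
  by rewrite addeC leeD2l.
move=> h1 h2.
have := le_trans (lee_wpmul2l (c0 : (0 <= (ln q + ln q)%:E)%E) h1) h2.
rewrite -leeBlDr// => h3; apply: le_trans h3.
by rewrite -EFinM -EFinB lee_fin; lra.
Qed.

End Transportation.

(** * Real inequalities: the constant 2.4, the alternatives, the simplex *)

Section RealInequalities.
Context {R : realType} {K : nat}.
Implicit Types (theta lambda w p N : 'I_K -> R) (a b : 'I_K).

(** The polynomial inequality left over in [ln_le_bernoulli_kl], with [u = ln (5/4)]. It is affine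
    in [u], so the sign of [2 - 6 d] selects the extreme value; the squares are centred near the
    minimizers of the resulting quadratics in [d]. *)
Lemma tangent_slack (d u : R) : 0 < d -> d < 2^-1 -> 19 / 90 <= u -> u <= 1 / 4 ->
  2 / 3 * (1 - 2 * d) <=
  (1 - d) * ((2 - 6 * d) * u + (1 - 2 * d) * (3 / 128) + 1 / 3).
Proof.
move=> d0 d2 u0 u1; have d1 : 0 <= 1 - d by lra.
have [d3|d3] := lerP d (1 / 3).
  have e : 0 <= 2 - 6 * d by lra.
  have := ler_wpM2l d1 (ler_wpM2l e u0).
  by have := sqr_ge0 (d - 289 / 1000); rewrite expr2; lra.
have e : 2 - 6 * d <= 0 by lra.
have := ler_wpM2l d1 (ler_wnM2l e u1).
by have := sqr_ge0 (d - 346 / 1000); rewrite expr2; lra.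
Qed.

(* Tangents at [1/3] and [2/3] leave a multiple of [ln 2] and [ln 5]; since
   [2 = (5/4)^3 * (128/125)], the multiple of [ln (5/4)] vanishes at [1/3] and
   crude bounds on it suffice. *)
Lemma ln_le_bernoulli_kl (d : R) : 0 < d < 2^-1 ->
  ln ((12 / 5 * d)^-1) <= (1 - 2 * d) * ln ((1 - d) / d).
Proof.
move=> /andP[d0 d2]; have d1 : 0 < 1 - d by lra.
set u : R := ln (5 / 4); set v : R := ln (128 / 125); set l3 : R := ln 3.
have l2 : ln 2 = 3 * u + v :> R.
  have -> : 2 = 5 / 4 * (5 / 4) * (5 / 4) * (128 / 125) :> R by field.
  have ln3 (x y : R) : 0 < x -> 0 < y -> ln (x * x * x * y) = 3 * ln x + ln y.
    by move=> x0 y0; rewrite !lnM ?posrE ?mulr_gt0//; ring.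
  by rewrite ln3 ?divr_gt0.
have u1 : u <= 1 / 4.
  by have := @ln_tangent R (5 / 4) 1 ltac:(lra) ltac:(lra); rewrite ln1 -/u; lra.
have u0 : 19 / 90 <= u.
  (* As [4/5 = 9/10 * 8/9], two tangents at 1 give [1/10 + 1/9 = 19/90], better than the [1/5] of a
     single one. *)
  have -> : u = - (ln (9 / 10) + ln (8 / 9)).
    rewrite -lnM ?posrE ?divr_gt0// -lnV ?posrE ?mulr_gt0 ?invr_gt0//.
    by congr ln; field.
  have := @ln_tangent R (9 / 10) 1 ltac:(lra) ltac:(lra).
  have := @ln_tangent R (8 / 9) 1 ltac:(lra) ltac:(lra).
  by rewrite ln1; lra.
have v0 : 3 / 128 <= v.
  have -> : v = - ln (125 / 128).
    by rewrite -lnV ?posrE ?divr_gt0//; congr ln; field.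
  by have := @ln_tangent R (125 / 128) 1 ltac:(lra) ltac:(lra); rewrite ln1; lra.
have t1 := @ln_tangent R (1 / 3) d ltac:(lra) d0.
have t2 := @ln_tangent R (2 / 3) (1 - d) ltac:(lra) d1.
have e1 : ln (1 / 3) = - l3 :> R by rewrite div1r lnV ?posrE.
have e2 : ln (2 / 3) = 3 * u + v - l3 :> R by rewrite ln_div ?posrE// l2.
have e3 : ln (12 / 5) = l3 - u :> R.
  have -> : 12 / 5 = 3 / (5 / 4) :> R by field.
  by rewrite ln_div ?posrE ?divr_gt0.
rewrite lnV ?posrE ?mulr_gt0// lnM ?posrE ?divr_gt0// e3 ln_div ?posrE//.
move: t1 t2; rewrite e1 e2; move: (ln d) (ln (1 - d)) => x y t1 t2.
(* [h1] and [h2] are the tangent lines of the convex function [z ln z] at [1/3] and [2/3], evaluated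
   at [d] and [1 - d]. *)
have h1 : d * x >= d * (1 - l3) - 1 / 3.
  have : d * (- l3) <= d * (x + 1 / 3 / d - 1) by rewrite ler_pM2l.
  have : d * (1 / 3 / d) = 1 / 3 by field; rewrite gt_eqF.
  by move: (1 / 3 / d) => z; lra.
have h2 : (1 - d) * y >= (1 - d) * (3 * u + v - l3 + 1) - 2 / 3.
  have : (1 - d) * (3 * u + v - l3) <= (1 - d) * (y + 2 / 3 / (1 - d) - 1).
    by rewrite ler_pM2l.
  have : (1 - d) * (2 / 3 / (1 - d)) = 2 / 3 by field; rewrite gt_eqF.
  by move: (2 / 3 / (1 - d)) => z; lra.
have h3 : (1 - 2 * d) * y * (1 - d) >=
    (1 - 2 * d) * ((1 - d) * (3 * u + v - l3 + 1) - 2 / 3).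
  by rewrite -mulrA (mulrC y) ler_wpM2l//; lra.
have h4 : (1 - d) * (2 * (d * x)) >= (1 - d) * (2 * (d * (1 - l3) - 1 / 3)).
  by rewrite ler_pM2l// ler_pM2l.
have h5 : (1 - 2 * d) * v >= (1 - 2 * d) * (3 / 128).
  by rewrite ler_wpM2l//; lra.
(* The difference of the two sides is [(1 - 2 d) y + 2 d x + ln 3 - u]; multiplying by [1 - d] makes
   [h3] and [h4] applicable. *)
rewrite -subr_ge0 -(pmulr_rge0 _ d1).
have h6 := tangent_slack _ _ d0 d2 u0 u1.
have h7 : (1 - d) * ((1 - 2 * d) * v) >= (1 - d) * ((1 - 2 * d) * (3 / 128)).
  by rewrite ler_pM2l.
by move: u v h1 h2 h3 h4 h5 h6 h7 {l2 u0 u1 v0 e2 e3 t1 t2} => u v *; lra.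
Qed.

(* The alternatives for which [a] beats [astar] include points arbitrarily close
   to the one with both means moved to [x]; raising a maximal mean by [e] makes
   the best arm unique. *)
Lemma alternative_bound theta astar N (k x : R) a :
  a != astar -> (forall b, 0 <= N b) ->
  (forall lambda b', best_arm lambda b' -> b' != astar ->
     k <= \sum_b gauss_kl theta lambda b * N b) ->
  k <= (N a * (theta a - x) ^+ 2 + N astar * (theta astar - x) ^+ 2) / 2.
Proof.
move=> aa N0 H; apply/ler_addgt0Pr => e0 e0_gt0.
(* [C] bounds the growth of the cost per unit of [e <= 1]: arm [a] ends within [2 e] of [x], and
   every arm other than [a] and [astar] moves by at most [e]. *)
pose C := N a * (2 * `|theta a - x| + 2) + \sum_b N b.
have C0 : 0 <= C.
  by rewrite addr_ge0 ?sumr_ge0// mulr_ge0// addr_ge0// mulr_ge0.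
pose e := Num.min 1 (e0 / (C + 1)).
have e_gt0 : 0 < e by rewrite lt_min ltr01 divr_gt0// ltr_wpDl.
have e1 : e <= 1 by rewrite ge_min lexx.
have eC : e * C <= e0.
  have : e * (C + 1) <= e0 by rewrite -ler_pdivlMr ?ltr_wpDl// ge_min lexx orbT.
  nra.
pose mu b := if b == astar then x else if b == a then x + e else theta b.
(* A third arm may lie above [x + e], so [i] need not be [a]; it is never [astar], because [mu a]
   exceeds [mu astar]. *)
pose i := [arg max_(j > a) mu j]%O.
have mui b : mu b <= mu i.
  by rewrite /i; case: arg_maxP => // j _; apply.
pose lambda b := if b == i then mu b + e else mu b.
have ia : i != astar.
  apply/eqP => ia; have := mui a; rewrite ia /mu eqxx (negbTE aa) eqxx; lra.
have bl : best_arm lambda i.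
  by move=> b bi; rewrite /lambda eqxx (negbTE bi); have := mui b; lra.
apply: (le_trans (H _ _ bl ia)).
apply: (@le_trans _ _ ((N a * (theta a - x) ^+ 2 + N astar * (theta astar - x) ^+ 2) / 2
   + e * C)); last by rewrite lerD2l.
rewrite (bigD1 astar)//= (bigD1 a)//=.
have -> : gauss_kl theta lambda astar = (theta astar - x) ^+ 2 / 2.
  by rewrite /gauss_kl /lambda eq_sym (negbTE ia) /mu eqxx.
have ha : gauss_kl theta lambda a <= (theta a - x) ^+ 2 / 2
    + e * (2 * `|theta a - x| + 2).
  have n0 := normr_ge0 (theta a - x).
  have n1 := ler_norm (theta a - x).
  have n2 : - (theta a - x) <= `|theta a - x| by rewrite -normrN ler_norm.
  rewrite /gauss_kl /lambda /mu (negbTE aa) eqxx.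
  by move: (`|_|) n0 n1 n2 => n n0 n1 n2; case: ifP => _; nra.
have hb : \sum_(b | (b != astar) && (b != a)) gauss_kl theta lambda b * N b
    <= e * \sum_b N b.
  rewrite mulr_sumr [leRHS](bigID (fun b => (b != astar) && (b != a)))/=.
  rewrite ler_wpDr ?sumr_ge0// => [b _|]; first by rewrite mulr_ge0// ltW.
  apply: ler_sum => b /andP[b1 b2]; rewrite ler_wpM2r//.
  rewrite /gauss_kl /lambda /mu (negbTE b1) (negbTE b2).
  by case: ifP => _; nra.
have : gauss_kl theta lambda a * N a <=
    ((theta a - x) ^+ 2 / 2 + e * (2 * `|theta a - x| + 2)) * N a by rewrite ler_wpM2r.
move: hb; rewrite /C; move: (\sum_(b | _) _) (\sum_b _) (gauss_kl _ _ _ * _) => s1 s2 s3.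
lra.
Qed.

(** An arm with zero count could be moved onto the other at no cost, against [0 < k]. With both
    counts positive, the weighted average of the two means is the cheapest common value. *)
Lemma two_arm_bound theta astar N (k : R) a :
  a != astar -> (forall b, 0 <= N b) -> 0 < k ->
  (forall lambda b', best_arm lambda b' -> b' != astar ->
     k <= \sum_b gauss_kl theta lambda b * N b) ->
  [/\ 0 < N a, 0 < N astar &
    2 * k * ((N a)^-1 + (N astar)^-1) <= (theta astar - theta a) ^+ 2].
Proof.
move=> aa N0 k0 H.
have B x := alternative_bound theta astar N k x a aa N0 H.
have Na : 0 < N a.
  rewrite lt_neqAle N0 andbT eq_sym; apply/eqP => z.
  by have := B (theta astar); rewrite z subrr expr0n /=; lra.
have Ns : 0 < N astar.
  rewrite lt_neqAle N0 andbT eq_sym; apply/eqP => z.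
  by have := B (theta a); rewrite z subrr expr0n /=; lra.
split=> //; have S0 : N a + N astar != 0 by rewrite gt_eqF// addr_gt0.
have := B ((N a * theta a + N astar * theta astar) / (N a + N astar)).
set L := (X in k <= X / 2).
have -> : L = (theta astar - theta a) ^+ 2 * (N a * N astar) / (N a + N astar).
  by rewrite /L; field.
set D := (theta astar - theta a) ^+ 2.
have -> : (N a)^-1 + (N astar)^-1 = (N a + N astar) / (N a * N astar).
  by field; rewrite !gt_eqF.
move=> h; rewrite mulrA ler_pdivrMr ?mulr_gt0//.
have : k * 2 <= D * (N a * N astar) / (N a + N astar) by lra.
by rewrite ler_pdivlMr ?addr_gt0//; lra.
Qed.

(** Raise [w] to [max(w, p)], of total [V <= 1 + K e], then remove the excess [V - 1] by moving all
    coordinates towards [p] in the same ratio; none falls by more than the excess. *)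
Lemma simplex_repair p w (e : R) : 0 <= e ->
  (forall a, 0 <= p a) -> \sum_a p a <= 1 -> \sum_a w a = 1 ->
  (forall a, p a - e <= w a) ->
  exists w', [/\ forall a, p a <= w' a, \sum_a w' a = 1 &
    forall a, w a - K%:R * e <= w' a].
Proof.
move=> e0 p0 p1 w1 pw.
pose v a := Num.max (w a) (p a).
have vw a : w a <= v a by rewrite le_max lexx.
have vp a : p a <= v a by rewrite le_max lexx orbT.
have ve a : v a <= w a + e.
  by rewrite ge_max; apply/andP; split; have := pw a; lra.
pose V := \sum_a v a; pose P := \sum_a p a.
have V1 : 1 <= V by rewrite -w1; exact: ler_sum.
have VK : V - 1 <= K%:R * e.
  have : V <= \sum_a (w a + e) by exact: ler_sum.
  by rewrite big_split /= w1 sumr_const card_ord -mulr_natl; lra.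
have P1 : P <= 1 by [].
pose r := (V - 1) / (V - P).
have r0 : 0 <= r by rewrite divr_ge0; lra.
have rE : (V - P) * r = V - 1.
  (* If [V = P], both equal 1 and there is no excess to remove; division by zero then makes [r]
     zero. *)
  have [z|nz] := eqVneq (V - P) 0; last by rewrite mulrC divfK.
  by rewrite z mul0r; lra.
have r1 : r <= 1.
  have [z|nz] := eqVneq (V - P) 0; first by rewrite /r z invr0 mulr0.
  by rewrite ler_pdivrMr; [lra|rewrite lt_neqAle eq_sym nz /=; lra].
exists (fun a => v a - (v a - p a) * r); split.
- by move=> a; have := vp a; nra.
- by rewrite sumrB -mulr_suml sumrB -/V -/P rE; lra.
- move=> a.
  have : (v a - p a) * r <= (V - P) * r.
    rewrite ler_wpM2r// /V /P -sumrB (bigD1 a)//= lerDl sumr_ge0// => b _.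
    by rewrite subr_ge0.
  by have := vw a; rewrite rE; lra.
Qed.

End RealInequalities.

(** * The characteristic time and the sampling proportions *)

Section CharacteristicTime.
Context {R : realType} {K : nat}.
Hypothesis K_ge2 : (2 <= K)%N.
Implicit Types (theta p w N : 'I_K -> R) (a b : 'I_K).

Lemma exists_other_arm b : exists a : 'I_K, a != b.
Proof.
have : (0 < #|predC1 b|)%N by rewrite cardC1 card_ord -subn1 subn_gt0.
by move=> /card_gt0P[a]; rewrite inE; exists a.
Qed.

Lemma einv_ge0 (x : R) : 0 <= x -> (0 <= einv x)%E.
Proof.
by move=> x0; rewrite /einv; case: ifP => _ //; rewrite lee_fin invr_ge0.
Qed.

(** A second arm keeps the maximum above [-oo]. *)
Lemma Tstar_ge0 p theta b : (0 <= Tstar p theta b)%E.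
Proof.
apply: mule_ge0 => //; apply/ereal_infP => _ [w [w01 _] <-].
have [a ab] := exists_other_arm b.
have ge_term (F : 'I_K -> \bar R) :
    (F a <= \big[Order.max/-oo]_(c | c != b) F c)%E.
  exact: (@le_bigmax_cond _ (\bar R) _ -oo%E a (fun c => c != b) F ab).
apply: le_trans (ge_term _).
apply: mule_ge0; last by rewrite lee_fin invr_ge0 sqr_ge0.
by apply: adde_ge0; apply: einv_ge0; [case/andP: (w01 a)|case/andP: (w01 b)].
Qed.

Lemma Tstar_le p theta b w (x : R) : best_arm theta b ->
  (forall a, 0 <= p a) -> (forall a, p a <= w a) -> \sum_a w a = 1 ->
  (forall a, a != b -> [/\ 0 < w a, 0 < w b &
     2 * ((w a)^-1 + (w b)^-1) <= (theta b - theta a) ^+ 2 * x]) ->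
  (Tstar p theta b <= x%:E)%E.
Proof.
move=> best p0 pw w1 H.
have w0 a : 0 <= w a by exact: le_trans (pw a).
have Sw : Sigma_p p w.
  split=> [a|]; last by split.
  by rewrite w0 -w1 (bigD1 a)//= lerDl sumr_ge0.
have -> : x%:E = (2%:E * (x / 2)%:E)%E by rewrite -EFinM mulrC divfK.
apply: lee_wpmul2l => //.
apply: (@le_trans _ _ (\big[Order.max/-oo%E]_(a | a != b)
    ((einv (w a) + einv (w b)) * (((theta b - theta a) ^+ 2)^-1)%:E)%E)).
  by apply: ereal_inf_lbound; exists w.
apply: (@bigmax_le _ (\bar R)) => [|a ab]; first exact: leNye.
have [wa wb h] := H a ab.
rewrite /einv !gt_eqF// -EFinD -EFinM lee_fin.
have D0 : 0 < (theta b - theta a) ^+ 2 by rewrite exprn_gt0// subr_gt0 best.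
by rewrite ler_pdivrMr//; lra.
Qed.

(** [L] stands for [ln (1 / (2.4 delta))], which may be negative; positivity of the counts comes
    from [k]. *)
Lemma count_proportions theta b N (k L : R) :
  (forall a, 0 <= N a) -> 0 < k -> L <= k ->
  (forall lambda b', best_arm lambda b' -> b' != b ->
     k <= \sum_a gauss_kl theta lambda a * N a) ->
  let T := \sum_a N a in
  [/\ 0 < T, \sum_a N a / T = 1 &
    forall a, a != b -> [/\ 0 < N a / T, 0 < N b / T &
      2 * L * ((N a / T)^-1 + (N b / T)^-1) <= (theta b - theta a) ^+ 2 * T]].
Proof.
move=> N0 k0 kL klb T.
have TB a ab := two_arm_bound theta b N k a ab N0 k0 klb.
have T0 : 0 < T.
  have [a ab] := exists_other_arm b; have [Na _ _] := TB a ab.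
  by rewrite /T (bigD1 a)//= ltr_pwDl// sumr_ge0.
split=> //; first by rewrite -mulr_suml divff// gt_eqF.
move=> a ab; have [Na Nb h] := TB a ab; split; [exact: divr_gt0|exact: divr_gt0|].
rewrite !invf_div -mulrDr mulrCA mulrC ler_pM2r//.
apply: le_trans h; rewrite ler_wpM2r ?addr_ge0 ?invr_ge0//.
by rewrite ler_pM2l.
Qed.

(** A finite expected stopping time makes all expected counts finite; [w] collects their shares of
    [T], and [kl_lower_bound] feeds [count_proportions]. *)
Lemma sample_proportions (A : algo R K) theta b (delta T : R) : valid_algo A ->
  0 < delta < 2^-1 ->
  (forall lambda b', best_arm lambda b' ->
     (Perr lambda A b' <= delta%:E)%E /\ Pfinite lambda A = 1%E) ->
  best_arm theta b -> Etau theta A = T%:E ->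
  exists w, [/\ 0 < T, forall a, ENa theta A a = (w a * T)%:E, \sum_a w a = 1 &
    forall a, a != b -> [/\ 0 < w a, 0 < w b &
      2 * ln ((12 / 5 * delta)^-1) * ((w a)^-1 + (w b)^-1) <=
      (theta b - theta a) ^+ 2 * T]].
Proof.
move=> vA d01 PAC best ET; have /andP[d0 d2] := d01.
have E0 a : (0 <= ENa theta A a)%E.
  by apply: nneseries_ge0 => n _ _; exact: Pn_ge0.
have Efin a : ENa theta A a \is a fin_num.
  rewrite ge0_fin_numE//; apply: (@le_lt_trans _ _ T%:E); last exact: ltry.
  rewrite -ET -(sum_ENa A vA theta) (bigD1 a)//= leeDl//.
  by apply: sume_ge0 => c _; exact: E0.
pose N a := fine (ENa theta A a).
have NE a : ENa theta A a = (N a)%:E by rewrite fineK.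
have N0 a : 0 <= N a by exact: fine_ge0.
have NT : \sum_a N a = T.
  apply: EFin_inj; rewrite -ET -(sum_ENa A vA theta) -sumEFin.
  by apply: eq_bigr => a _; rewrite NE.
pose k := (1 - 2 * delta) * ln ((1 - delta) / delta).
have k0 : 0 < k.
  by rewrite mulr_gt0//; [lra|rewrite ln_gt0// ltr_pdivlMr//; lra].
have kL := ln_le_bernoulli_kl delta d01.
have klb lambda b' : best_arm lambda b' -> b' != b ->
    k <= \sum_a gauss_kl theta lambda a * N a.
  move=> bl bb; rewrite -lee_fin -sumEFin.
  under eq_bigr do rewrite EFinM -NE.
  by apply: (kl_lower_bound A vA theta lambda delta b b') => //;
    [case: (PAC _ _ best)|case: (PAC _ _ best)|case: (PAC _ _ bl)].
have [T0 w1 H] := count_proportions theta b N _ _ N0 k0 kL klb.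
rewrite NT in T0 w1 H.
exists (fun a => N a / T); split => // a.
by rewrite NE divfK// gt_eqF.
Qed.

(* Shifting the proportions by at most a fraction of their common lower bound
   multiplies the inverse proportions by a factor close to 1. *)
Lemma Tstar_le_perturb p theta b w (e M M' : R) : best_arm theta b ->
  (forall a, 0 <= p a) -> \sum_a p a <= 1 -> \sum_a w a = 1 ->
  0 < M -> M < M' -> 0 <= e ->
  K%:R * e <= (1 - M / M') * (2 / (M * (1 + \sum_a (theta b - theta a) ^+ 2))) ->
  (forall a, p a - e <= w a) ->
  (forall a, a != b -> [/\ 0 < w a, 0 < w b &
     2 * ((w a)^-1 + (w b)^-1) <= (theta b - theta a) ^+ 2 * M]) ->
  (Tstar p theta b <= M'%:E)%E.
Proof.
move=> best p0 p1 w1 M0 MM' e0 Ke pw H.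
have [w' [pw' w1' ww']] := simplex_repair p w e e0 p0 p1 w1 pw.
apply: (Tstar_le p theta b w') => // a ab; have [wa wb h] := H a ab.
set D := 1 + \sum_c _ in Ke.
have D0 : 0 < D by rewrite ltr_pwDl// sumr_ge0// => c _; exact: sqr_ge0.
have aD : (theta b - theta a) ^+ 2 <= D.
  by rewrite /D (bigD1 a)//= addrCA lerDl addr_ge0// sumr_ge0// => c _; exact: sqr_ge0.
have M'0 : 0 < M' by exact: lt_trans MM'.
have MD0 : 0 < M * D by exact: mulr_gt0.
have q0 : 0 < M / M' by exact: divr_gt0.
have q1 : M / M' < 1 by rewrite ltr_pdivrMr// mul1r.
have hD : 2 * ((w a)^-1 + (w b)^-1) <= M * D.
  by apply: (le_trans h); rewrite mulrC ler_pM2l.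
have low c : 0 < w c -> 2 * (w c)^-1 <= M * D ->
    0 < w' c /\ (w' c)^-1 <= (w c)^-1 * (M' / M).
  move=> wc hc.
  have cw : 2 / (M * D) <= w c by rewrite ler_pdivrMr// mulrC -ler_pdivrMr.
  have ww : M / M' * w c <= w' c.
    have := ww' c; have : 0 <= 1 - M / M' by lra.
    by move: (M / M') (2 / (M * D)) (K%:R * e) Ke cw => q x y; nra.
  have w'0 : 0 < w' c by apply: lt_le_trans ww; exact: mulr_gt0.
  split=> //; rewrite -[M' / M]invf_div -invfM lef_pV2 ?posrE ?mulr_gt0 ?invr_gt0//.
  by rewrite mulrC.
have wa' := invr_gt0 (w a); have wb' := invr_gt0 (w b).
rewrite wa in wa'; rewrite wb in wb'.
have [|a'0 ha] := low a wa; first by lra.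
have [|b'0 hb] := low b wb; first by lra.
split=> //.
have : 2 * ((w a)^-1 + (w b)^-1) * (M' / M) <= (theta b - theta a) ^+ 2 * M * (M' / M).
  by rewrite ler_pM2r// divr_gt0.
have -> : (theta b - theta a) ^+ 2 * M * (M' / M) = (theta b - theta a) ^+ 2 * M'.
  by field; rewrite gt_eqF.
by lra.
Qed.

End CharacteristicTime.

(** * The two lower bounds on the expected stopping time *)

Lemma Etau_ge0 {R : realType} {K : nat} (A : algo R K) theta : valid_algo A ->
  (0 <= Etau theta A)%E.
Proof. by move=> vA; apply: nneseries_ge0 => n _ _; exact: Pn_ge0. Qed.

Theorem theorem1 (R : realType) (K : nat) (HK : (2 <= K)%N) :
  (* (a) pre-specified constraints *)
  (forall p : 'I_K -> R,
     (forall a, 0 <= p a <= 1) -> \sum_(a < K) p a <= 1 ->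
   forall A : R -> algo R K,
     (forall delta : R, 0 < delta < 2^-1 -> valid_algo (A delta)) ->
     pfair_PAC p A ->
   forall (theta : 'I_K -> R) (astar : 'I_K), best_arm theta astar ->
   forall delta : R, 0 < delta < 2^-1 ->
     (Tstar p theta astar * (ln ((12 / 5 * delta)^-1))%:E <= Etau theta (A delta))%E)
  /\
  (* (b) theta-dependent constraints *)
  (forall p : ('I_K -> R) -> 'I_K -> R,
     continuous (p : {ptws 'I_K -> R} -> {ptws 'I_K -> R}) ->
     (forall theta' a, 0 <= p theta' a <= 1) ->
     (forall theta', \sum_(a < K) p theta' a <= 1) ->
   forall A : R -> algo R K,
     (forall delta : R, 0 < delta < 2^-1 -> valid_algo (A delta)) ->
     asym_pfair_PAC p A ->
   forall (theta : 'I_K -> R) (astar : 'I_K), best_arm theta astar ->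
     (* liminf_{delta -> 0} E[tau_delta] / log(1/delta) >= T*_{p(theta)}(theta) *)
     forall M : R, (M%:E < Tstar (p theta) theta astar)%E ->
       \forall delta \near 0^'+,
         ((M * ln (delta^-1))%:E <= Etau theta (A delta))%E).
Proof.
split.
  move=> p p01 _ A vA fair theta b best delta d01.
  have vAd := vA _ d01.
  have [Einf|Efin] := leP +oo%E (Etau theta (A delta)).
    exact: le_trans (leey _) Einf.
  have E0 := Etau_ge0 (A delta) theta vAd.
  have ET : Etau theta (A delta) = (fine (Etau theta (A delta)))%:E.
    by rewrite fineK// ge0_fin_numE.
  have PAC lambda b' : best_arm lambda b' ->
      (Perr lambda (A delta) b' <= delta%:E)%E /\ Pfinite lambda (A delta) = 1%E.
    by move=> bl; case: (fair _ _ bl _ d01).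
  have [w [T0 EN w1 H]] :=
    sample_proportions HK (A delta) theta b delta _ vAd d01 PAC best ET.
  move: (fine _) ET T0 EN H => T ET T0 EN H; rewrite ET.
  set L := ln _ in H *.
  (* For [delta >= 5/12] the logarithm is not positive and the bound is trivial. *)
  have [L0|L0] := leP L 0.
    apply: (@le_trans _ _ 0%E); last by rewrite lee_fin ltW.
    by rewrite mule_ge0_le0 ?Tstar_ge0.
  rewrite -lee_pdivlMr//; apply: (Tstar_le p theta b w) => //.
  - by move=> a; case/andP: (p01 a).
  - move=> a; have [pa _] := fair _ _ best _ d01; have := pa a.
    by rewrite ET EN -EFinM lee_fin ler_pM2r.
  - move=> a ab; have [wa wb h] := H a ab; split=> //.
    by rewrite mulrA ler_pdivlMr//; lra.
move=> p _ p01 p1 A vA fair theta b best M MT.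
have [M0|M0] := leP M 0.
  near=> delta.
  have d0 : 0 < delta by near: delta; exact: nbhs_right_gt.
  have d2 : delta < 2^-1 by near: delta; apply: nbhs_right_lt.
  have d01 : 0 < delta < 2^-1 by rewrite d0.
  apply: le_trans (Etau_ge0 (A delta) theta (vA _ d01)).
  rewrite lee_fin mulr_le0_ge0// ln_ge0// invf_ge1//; lra.
(* The gap between [M] and the characteristic time is split: from [M] to [M2] it absorbs the
   constant [ln (12/5)], from [M2] to [M1] the defect of fairness. *)
have [M1 MM1 M1T] : exists2 M1, M < M1 & (M1%:E < Tstar (p theta) theta b)%E.
  move: MT; case: (Tstar _ _ _) => [r| |] //.
    by rewrite lte_fin => Mr; exists ((M + r) / 2); rewrite ?lte_fin; lra.
  by move=> _; exists (M + 1); [lra|exact: ltry].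
pose M2 := (M + M1) / 2.
have MM2 : M < M2 by rewrite /M2; lra.
have M21 : M2 < M1 by rewrite /M2; lra.
have M20 : 0 < M2 by exact: lt_trans MM2.
(* The largest defect of fairness that [Tstar_le_perturb] tolerates between [M2] and [M1]. *)
pose eta := (1 - M2 / M1) * (2 / (M2 * (1 + \sum_a (theta b - theta a) ^+ 2))) / K%:R.
have K0 : 0 < K%:R :> R by rewrite ltr0n (leq_trans _ HK).
have eta0 : 0 < eta.
  rewrite divr_gt0// mulr_gt0//.
    by rewrite subr_gt0 ltr_pdivrMr ?mul1r//; exact: lt_trans M21.
  rewrite divr_gt0// mulr_gt0// ltr_pwDl// sumr_ge0// => c _; exact: sqr_ge0.
(* From [ln (1 / delta) >= x] on, [M ln (1 / delta) <= M2 (ln (1 / delta) - ln (12/5))]. *)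
pose x := M2 * ln (12 / 5) / (M2 - M).
have fair_near : \forall delta \near 0^'+, forall a,
    ((p theta a - eta)%:E * Etau theta (A delta) <= ENa theta (A delta) a)%E.
  apply: filter_forall => a; have [_ fa] := fair _ _ best.
  by apply: fa; rewrite ltrBlDr ltrDl.
near=> delta.
have d0 : 0 < delta by near: delta; exact: nbhs_right_gt.
have d2 : delta < 2^-1 by near: delta; apply: nbhs_right_lt.
have d01 : 0 < delta < 2^-1 by rewrite d0.
have vAd := vA _ d01.
have dx : delta < expR (- x) by near: delta; apply: nbhs_right_lt; exact: expR_gt0.
have fd : forall a, ((p theta a - eta)%:E * Etau theta (A delta) <=
    ENa theta (A delta) a)%E by near: delta.
(* A smaller expectation would be finite, and its proportions would push the characteristic time
   down to [M1]. *)
rewrite leNgt; apply/negP => lt.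
have E0 := Etau_ge0 (A delta) theta vAd.
have ET : Etau theta (A delta) = (fine (Etau theta (A delta)))%:E.
  by rewrite fineK// ge0_fin_numE// (lt_trans lt)// ltry.
have PAC lambda b' : best_arm lambda b' ->
    (Perr lambda (A delta) b' <= delta%:E)%E /\ Pfinite lambda (A delta) = 1%E.
  by move=> bl; case: (fair _ _ bl) => + _; apply.
have [w [T0 EN w1 H]] :=
  sample_proportions HK (A delta) theta b delta _ vAd d01 PAC best ET.
move: (fine _) ET T0 EN H => T ET T0 EN H.
move: lt; rewrite ET lte_fin lnV ?posrE// => lt.
have lx : x <= - ln delta.
  by rewrite lerNr -[leRHS]expRK ler_ln ?posrE ?expR_gt0// ltW.
have ML : M * - ln delta <= M2 * ln ((12 / 5 * delta)^-1).
  have -> : ln ((12 / 5 * delta)^-1) = - ln delta - ln (12 / 5).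
    rewrite lnV ?posrE ?mulr_gt0 ?divr_gt0// lnM ?posrE ?divr_gt0//.
    by rewrite opprD addrC.
  move: lx; rewrite ler_pdivrMr ?subr_gt0//; lra.
have TL : T < M2 * ln ((12 / 5 * delta)^-1) by exact: lt_le_trans ML.
set L := ln _ in H TL.
have L0 : 0 < L by have := lt_trans T0 TL; rewrite pmulr_rgt0.
have : (Tstar (p theta) theta b <= M1%:E)%E.
  apply: (Tstar_le_perturb (p theta) theta b w eta M2 M1) => //.
  - by move=> a; case/andP: (p01 theta a).
  - exact: ltW.
  - by rewrite /eta mulrC divfK// gt_eqF.
  - by move=> a; have := fd a; rewrite ET EN -EFinM lee_fin ler_pM2r.
  - move=> a ab; have [wa wb h] := H a ab; split=> //.
    rewrite -(ler_pM2l L0).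
    have : (theta b - theta a) ^+ 2 * T <= (theta b - theta a) ^+ 2 * (M2 * L).
      by rewrite ler_wpM2l ?sqr_ge0// ltW.
    lra.
by rewrite leNgt M1T.
Unshelve. all: by end_near.
Qed.
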